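(* Let $(g_L,Z,\lambda,\rho)$ be a Lyra almost Ricci--Bourguignon soliton on a Lyra twisted warped product $M=M_1\times_fM_2$ with scale $\varphi$, where $Z=Z_1+Z_2$ is projectable. Put $k=\ln f$, $\sigma=\ln\varphi$ and assume $\sigma=\sigma_1$ and $k=k_1+k_2$ with $\sigma_1,k_1\in C^\infty(M_1)$, $k_2\in C^\infty(M_2)$. Let $g_{L,1}=e^{2\sigma_1}g_1$ on $M_1$, with Ricci tensor $\operatorname{Ric}^{L,1}$ and scalar curvature $R^{L,1}$, and define $$\mathcal B_1=\operatorname{Hess}_1k_1+dk_1\otimes dk_1+\operatorname{Hess}_1\sigma_1-d\sigma_1\otimes d\sigma_1,\qquad b_1=\langle\nabla_1k_1,\nabla_1\sigma_1\rangle_{g_1}+|\nabla_1\sigma_1|_{g_1}^2 .$$ For each fixed $y\in M_2$, $(M_1,g_{L,1},Z_1)$ inherits a Lyra almost Ricci--Bourguignon soliton structure with parameter $\rho$ (that is, there is $\lambda_{1,y}\in C^\infty(M_1)$ with $\operatorname{Ric}^{L,1}+\frac12\mathcal L_{Z_1}g_{L,1}=(\lambda_{1,y}+\rho R^{L,1})g_{L,1}$) if and only if $$\operatorname{tf}_{g_1}\mathcal B_1=0 .$$ More precisely, if $\mathcal B_1=\beta_1g_1$, then the inherited soliton function is $$\lambda_{1,y}=\lambda+\rho(R^L-R^{L,1})+n_2e^{-2\sigma_1}(\beta_1+b_1),$$ the right-hand side being evaluated on the slice $M_1\times\{y\}$. A single soliton structure on $M_1$, independent of the choice of $y$, is obtained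 if and only if the right-hand side of this formula is independent of the fiber variable $y$.
   Context: Lyra twisted warped product: $(M_1,g_1),(M_2,g_2)$ are smooth pseudo-Riemannian manifolds of positive dimensions $n_1,n_2$, $n=n_1+n_2$; $f,\varphi:M_1\times M_2\to(0,\infty)$ are smooth; $M=M_1\times M_2$ carries $g=g_1\oplus f^2g_2$ and $g_L=\varphi^2g=e^{2\sigma}g$. $\operatorname{Ric}^L,R^L$ are the Ricci tensor and scalar curvature of $g_L$. A Lyra almost Ricci--Bourguignon soliton is $(g_L,Z,\lambda,\rho)$ with $Z$ a vector field on $M$, $\lambda\in C^\infty(M)$, $\rho\in\mathbb R$, satisfying $\operatorname{Ric}^L+\frac12\mathcal L_Zg_L=(\lambda+\rho R^L)g_L$. $Z$ is projectable, $Z=Z_1+Z_2$, if $Z_1,Z_2$ are canonical lifts of vector fields on $M_1,M_2$ (denoted by the same letters). $\nabla_1,\operatorname{Hess}_1$ are gradient and Hessian of $(M_1,g_1)$; $|v|^2=\langle v,v\rangle$. For a symmetric $(0,2)$-tensor $S$ on an $m$-dimensional $(N,h)$, $\operatorname{tf}_hS=S-\frac1m(\operatorname{tr}_hS)h$. *)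

(* Defs.v *)
From HB Require Import structures.
From mathcomp Require Import all_boot all_order all_algebra.
From mathcomp Require Import all_classical all_reals all_analysis.
Import Order.TTheory GRing.Theory Num.Theory.
Import numFieldNormedType.Exports.
Set Implicit Arguments.
Unset Strict Implicit.
Unset Printing Implicit Defensive.
Local Open Scope classical_set_scope.
Local Open Scope ring_scope.

Definition partial (R : realType) (n : nat) (i : 'I_n) (h : 'rV[R]_n -> R) :
    'rV[R]_n -> R :=
  fun u => 'D_(delta_mx 0 i) h u.

(* C^oo on U: all iterated partial derivatives exist and are Frechet
   differentiable (hence continuous) at every point of U.  Only used for
   open U. *)
Definition smooth_on (R : realType) (n : nat) (U : set 'rV[R]_n)
    (h : 'rV[R]_n -> R) : Prop :=
  forall (s : seq 'I_n) (u : 'rV[R]_n), U u ->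
    differentiable (foldr (@partial R n) h s) u.

Definition diff_row (R : realType) (n : nat) (h : 'rV[R]_n -> R)
    (u : 'rV[R]_n) : 'rV[R]_n :=
  \row_i partial i h u.

(* Gamma^k_{ij} of the metric with coordinate matrix g *)
Definition christoffel (R : realType) (n : nat) (g : 'rV[R]_n -> 'M[R]_n)
    (k i j : 'I_n) (u : 'rV[R]_n) : R :=
  2^-1 * \sum_(l < n) invmx (g u) k l *
    (partial i (fun v => g v j l) u + partial j (fun v => g v i l) u
     - partial l (fun v => g v i j) u).

(* R^l_{kij}, with R(d_i, d_j) d_k = \sum_l R^l_{kij} d_l and
   R(X, Y) = [nabla_X, nabla_Y] - nabla_[X, Y] *)
Definition riemann (R : realType) (n : nat) (g : 'rV[R]_n -> 'M[R]_n)
    (l k i j : 'I_n) (u : 'rV[R]_n) : R :=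
  partial i (christoffel g l j k) u - partial j (christoffel g l i k) u
  + \sum_(m < n) (christoffel g l i m u * christoffel g m j k u
                  - christoffel g l j m u * christoffel g m i k u).

(* Ric(Y, W) = tr (X |-> R(X, Y) W), positive on round spheres *)
Definition ricci_mx (R : realType) (n : nat) (g : 'rV[R]_n -> 'M[R]_n)
    (u : 'rV[R]_n) : 'M[R]_n :=
  \matrix_(j, k) \sum_(i < n) riemann g i k i j u.

Definition hess_mx (R : realType) (n : nat) (g : 'rV[R]_n -> 'M[R]_n)
    (h : 'rV[R]_n -> R) (u : 'rV[R]_n) : 'M[R]_n :=
  \matrix_(i, j) (partial i (partial j h) u
                  - \sum_(k < n) christoffel g k i j u * partial k h u).

Definition lie_mx (R : realType) (n : nat) (Z : 'rV[R]_n -> 'rV[R]_n)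
    (g : 'rV[R]_n -> 'M[R]_n) (u : 'rV[R]_n) : 'M[R]_n :=
  \matrix_(i, j) \sum_(k < n)
    (Z u 0 k * partial k (fun v => g v i j) u
     + g u k j * partial i (fun v => Z v 0 k) u
     + g u i k * partial j (fun v => Z v 0 k) u).

Definition grad_row (R : realType) (n : nat) (g : 'rV[R]_n -> 'M[R]_n)
    (h : 'rV[R]_n -> R) (u : 'rV[R]_n) : 'rV[R]_n :=
  diff_row h u *m invmx (g u).

Definition inner_mx (R : realType) (n : nat) (G : 'M[R]_n) (v w : 'rV[R]_n) :
    R :=
  (v *m G *m w^T) 0 0.

Definition trace_mx (R : realType) (n : nat) (G S : 'M[R]_n) : R :=
  \tr (invmx G *m S).

Definition tracefree_mx (R : realType) (n : nat) (G S : 'M[R]_n) : 'M[R]_n :=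
  S - (n%:R^-1 * trace_mx G S) *: G.

(* The data of an atlas: charts [mcoord i : mdom i -> R^n] with inverse
   parametrizations [mparam i]; [mcoord i] and [mparam i] are total functions,
   meaningful on [mdom i] and [mcod i] only.  [mchart p] selects a chart around
   p, in which the value at p of a chart-independent scalar is computed. *)
Record atlas (R : realType) (n : nat) := Atlas {
  mpoint :> topologicalType;
  mindex : Type;
  mdom : mindex -> set mpoint;
  mcoord : mindex -> mpoint -> 'rV[R]_n;
  mparam : mindex -> 'rV[R]_n -> mpoint;
  mchart : mpoint -> mindex }.

Definition mcod (R : realType) (n : nat) (M : atlas R n) (i : mindex M) :
    set 'rV[R]_n :=
  mcoord i @` mdom i.

Definition transition (R : realType) (n : nat) (M : atlas R n)
    (i j : mindex M) : 'rV[R]_n -> 'rV[R]_n :=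
  mcoord j \o mparam i.

Definition overlap (R : realType) (n : nat) (M : atlas R n) (i j : mindex M) :
    set 'rV[R]_n :=
  mcoord i @` (mdom i `&` mdom j).

Record smooth_manifold (R : realType) (n : nat) (M : atlas R n) : Prop := {
  manifold_hausdorff : hausdorff_space M;
  manifold_countable : @second_countable M;
  manifold_chart : forall p : M, mdom (mchart p) p;
  manifold_dom_open : forall i : mindex M, open (mdom i);
  manifold_cod_open : forall i : mindex M, open (mcod i);
  manifold_coordK : forall (i : mindex M) (p : M),
    mdom i p -> mparam i (mcoord i p) = p;
  manifold_coord_continuous : forall i : mindex M,
    {within mdom i, continuous (mcoord i)};
  manifold_param_continuous : forall i : mindex M,
    {within mcod i, continuous (mparam i)};
  manifold_transition : forall (i j : mindex M) (k : 'I_n),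
    smooth_on (overlap i j) (fun u => transition i j u 0 k) }.

Definition smooth_fun (R : realType) (n : nat) (M : atlas R n) (h : M -> R) :
    Prop :=
  forall i : mindex M, smooth_on (mcod i) (h \o mparam i).

(* Vector fields and (0,2)-tensor fields are given by their components in
   every chart, as functions of the coordinates. *)
Definition vfield (R : realType) (n : nat) (M : atlas R n) : Type :=
  mindex M -> 'rV[R]_n -> 'rV[R]_n.

Definition tensor2 (R : realType) (n : nat) (M : atlas R n) : Type :=
  mindex M -> 'rV[R]_n -> 'M[R]_n.

(* Row vectors: 'D_v F u = v *m 'J F u. *)
Definition smooth_vfield (R : realType) (n : nat) (M : atlas R n)
    (Z : vfield M) : Prop :=
  (forall (i : mindex M) (k : 'I_n), smooth_on (mcod i) (fun u => Z i u 0 k))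
  /\ (forall (i j : mindex M) (u : 'rV[R]_n), overlap i j u ->
        Z j (transition i j u) = Z i u *m 'J (transition i j) u).

Definition smooth_tensor2 (R : realType) (n : nat) (M : atlas R n)
    (S : tensor2 M) : Prop :=
  (forall (i : mindex M) (k l : 'I_n), smooth_on (mcod i) (fun u => S i u k l))
  /\ (forall (i j : mindex M) (u : 'rV[R]_n), overlap i j u ->
        S i u = 'J (transition i j) u *m S j (transition i j u)
                *m ('J (transition i j) u)^T).

Definition eq_tensor2 (R : realType) (n : nat) (M : atlas R n)
    (S T : tensor2 M) : Prop :=
  forall (i : mindex M) (u : 'rV[R]_n), mcod i u -> S i u = T i u.

Definition pseudo_riemannian (R : realType) (n : nat) (M : atlas R n)
    (g : tensor2 M) : Prop :=
  smooth_tensor2 g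
  /\ (forall (i : mindex M) (u : 'rV[R]_n), mcod i u ->
        (g i u)^T = g i u /\ g i u \in unitmx).

Definition scale_tensor2 (R : realType) (n : nat) (M : atlas R n) (h : M -> R)
    (S : tensor2 M) : tensor2 M :=
  fun i u => h (mparam i u) *: S i u.

Definition ricci (R : realType) (n : nat) (M : atlas R n) (g : tensor2 M) :
    tensor2 M :=
  fun i => ricci_mx (g i).

Definition scalar_curvature (R : realType) (n : nat) (M : atlas R n)
    (g : tensor2 M) (p : M) : R :=
  let i := mchart p in let u := mcoord i p in
  trace_mx (g i u) (ricci g i u).

Definition lie_derivative (R : realType) (n : nat) (M : atlas R n)
    (Z : vfield M) (g : tensor2 M) : tensor2 M :=
  fun i => lie_mx (Z i) (g i).

Definition hessian (R : realType) (n : nat) (M : atlas R n) (g : tensor2 M)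
    (h : M -> R) : tensor2 M :=
  fun i => hess_mx (g i) (h \o mparam i).

Definition tensor_square (R : realType) (n : nat) (M : atlas R n)
    (h : M -> R) : tensor2 M :=
  fun i u => (diff_row (h \o mparam i) u)^T *m diff_row (h \o mparam i) u.

Definition gradient (R : realType) (n : nat) (M : atlas R n) (g : tensor2 M)
    (h : M -> R) : vfield M :=
  fun i => grad_row (g i) (h \o mparam i).

Definition inner (R : realType) (n : nat) (M : atlas R n) (g : tensor2 M)
    (V W : vfield M) (p : M) : R :=
  let i := mchart p in let u := mcoord i p in inner_mx (g i u) (V i u) (W i u).

Definition tracefree (R : realType) (n : nat) (M : atlas R n)
    (g S : tensor2 M) : tensor2 M :=
  fun i u => tracefree_mx (g i u) (S i u).

(* The metric [g] is the already rescaled one, phi^2 g in Lyra geometry. *)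
Definition almost_RB_soliton (R : realType) (n : nat) (M : atlas R n)
    (g : tensor2 M) (Z : vfield M) (lam : M -> R) (rho : R) : Prop :=
  [/\ pseudo_riemannian g, smooth_vfield Z, smooth_fun lam &
      eq_tensor2 (fun i u => ricci g i u + 2^-1 *: lie_derivative Z g i u)
        (scale_tensor2 (fun p => lam p + rho * scalar_curvature g p) g)].

Definition prod_atlas (R : realType) (n1 n2 : nat) (M1 : atlas R n1)
    (M2 : atlas R n2) : atlas R (n1 + n2) :=
  @Atlas R (n1 + n2) (M1 * M2)%type (mindex M1 * mindex M2)%type
    (fun i => mdom i.1 `*` mdom i.2)
    (fun i p => row_mx (mcoord i.1 p.1) (mcoord i.2 p.2))
    (fun i u => (mparam i.1 (lsubmx u), mparam i.2 (rsubmx u)))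
    (fun p => (mchart p.1, mchart p.2)).

(* Canonical lifts: the horizontal (resp. vertical) vector field related to Z1
   (resp. Z2) by the projection. *)
Definition lift1 (R : realType) (n1 n2 : nat) (M1 : atlas R n1)
    (M2 : atlas R n2) (Z1 : vfield M1) : vfield (prod_atlas M1 M2) :=
  fun i u => row_mx (Z1 i.1 (lsubmx u)) 0.

Definition lift2 (R : realType) (n1 n2 : nat) (M1 : atlas R n1)
    (M2 : atlas R n2) (Z2 : vfield M2) : vfield (prod_atlas M1 M2) :=
  fun i u => row_mx 0 (Z2 i.2 (rsubmx u)).

Definition projectable_sum (R : realType) (n1 n2 : nat) (M1 : atlas R n1)
    (M2 : atlas R n2) (Z : vfield (prod_atlas M1 M2)) (Z1 : vfield M1)
    (Z2 : vfield M2) : Prop :=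
  forall i u, mcod i u -> Z i u = lift1 Z1 i u + lift2 Z2 i u.

(* g1 (+) f^2 g2, with f a function on the whole product *)
Definition twisted_metric (R : realType) (n1 n2 : nat) (M1 : atlas R n1)
    (M2 : atlas R n2) (g1 : tensor2 M1) (g2 : tensor2 M2)
    (f : prod_atlas M1 M2 -> R) : tensor2 (prod_atlas M1 M2) :=
  fun i u => block_mx (g1 i.1 (lsubmx u)) 0
                      0 (f (mparam i u) ^+ 2 *: g2 i.2 (rsubmx u)).

Definition obstruction (R : realType) (n : nat) (M : atlas R n)
    (g : tensor2 M) (k sigma : M -> R) : tensor2 M :=
  fun i u => hessian g k i u + tensor_square k i u
             + hessian g sigma i u - tensor_square sigma i u.

Definition obstruction_scalar (R : realType) (n : nat) (M : atlas R n)
    (g : tensor2 M) (k sigma : M -> R) (p : M) : R :=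
  inner g (gradient g k) (gradient g sigma) p
  + inner g (gradient g sigma) (gradient g sigma) p.

(* Main.v *)
Require Import Defs.
From mathcomp Require Import all_boot all_order all_algebra.
From mathcomp Require Import all_classical all_reals all_analysis.
From mathcomp Require Import ring lra.
Import Order.TTheory GRing.Theory Num.Theory.
Import numFieldNormedType.Exports.
Set Implicit Arguments.
Unset Strict Implicit.
Unset Printing Implicit Defensive.
Local Open Scope classical_set_scope.
Local Open Scope ring_scope.

(* Since sigma lives on M1 and k splits, gL is the warped product of gL1 and
   e^{2 k2} g2 with warping function e^w, w = k1 + sigma1.  The horizontal block
   of its Ricci tensor is Ric(gL1) - n2 (Hess w + dw dw), the Hessian being that
   of gL1, and the conformal change formula turns the bracket into
   B1 + b1 g1.  The horizontal block of the soliton equation is thus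
     Ric(gL1) + 1/2 L_{Z1} gL1 = (lambda + rho RL) gL1 + n2 (B1 + b1 g1),
   and everything but the smoothness of the inherited soliton function is
   linear algebra.

   For smoothness, the pure-trace factor of B1 has to be independent of the
   chart, which holds because the Hessian of a function is a tensor.  Moreover
   RL1 is defined pointwise through a chart that varies with the point.  Its
   smoothness (needed for rho <> 0) comes from the soliton equation itself:
   lambda + rho RL is smooth by the horizontal block, hence so is RL, and
   RL - RL1 is computed from the horizontal Ricci block and from the vertical
   block of the soliton equation, which expresses the vertical Ricci block
   through the Lie derivative; on a slice this involves only smooth functions
   and a constant. *)

(** * Partial derivatives *)

(** Differentiability depends only on the germ: the first-order expansion of [f] at [x] is also one
    for [g], and uniqueness of the differential identifies the two differentials. *)
Lemma near_eq_differentiable (R : numFieldType) (V W : normedModType R)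
    (f g : V -> W) (x : V) :
  (\near x, f x = g x) -> differentiable f x -> differentiable g x.
Proof.
move=> fg dfx; have [cdf ef] := (diff_locallyP x f).1 dfx.
have fgx : f x = g x by exact: nbhs_singleton fg.
suff eg : g \o shift x = cst (g x) + 'd f x +o_ 0 id.
  by have dgE := diff_unique cdf eg; apply/diff_locallyP; rewrite dgE.
apply/eqaddoP => e e0; move/eqaddoP: ef => /(_ e e0) fe.
have fgs : \forall h \near 0, f (h + x) = g (h + x).
  by move: fg; rewrite (near_shift 0 x); apply: filterS => h /=; rewrite subr0.
near=> h.
have -> : (g \o shift x - (cst (g x) + 'd f x)) h
        = (f \o shift x - (cst (f x) + 'd f x)) h.
  rewrite /= !fctE /=; congr (_ - (_ + _)) => //.
  by apply/esym; near: h.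
by near: h.
Unshelve. all: by end_near. Qed.

Lemma differentiable_rowP (R : realType) (V : normedModType R) n
    (T : V -> 'rV[R]_n) (x : V) :
  (forall k, differentiable (fun v => T v 0 k) x) -> differentiable T x.
Proof.
move=> dT.
have -> : T = \sum_(k < n) (fun v => T v 0 k *: delta_mx 0 k).
  by apply/funext => v; rewrite fct_sumE [LHS]row_sum_delta.
by apply: differentiable_sum => k; apply: differentiableZl.
Qed.

Section Partial.
Variables (R : realType) (n : nat).
Implicit Types (h k : 'rV[R]_n -> R) (u : 'rV[R]_n) (U : set 'rV[R]_n).

Lemma partial_eq_on U h k (i : 'I_n) : open U -> {in U, h =1 k} ->
  {in U, partial i h =1 partial i k}.
Proof.
move=> oU hk u Uu; apply: near_eq_derive.
apply: (filterS (P := U)); last by apply: open_nbhs_nbhs; split=> //; rewrite inE in Uu.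
by move=> v Uv; apply: hk; rewrite inE.
Qed.

Lemma partialE h i u : differentiable h u -> partial i h u = 'd h u (delta_mx 0 i).
Proof. by move=> dh; rewrite /partial deriveE. Qed.

Lemma partial_cst (a : R) i u : partial i (fun=> a) u = 0.
Proof. exact: derive_cst. Qed.

Lemma partialD h k i u : differentiable h u -> differentiable k u ->
  partial i (fun v => h v + k v) u = partial i h u + partial i k u.
Proof. by move=> dh dk; apply: deriveD; exact: diff_derivable. Qed.

Lemma partialM h k i u : differentiable h u -> differentiable k u ->
  partial i (fun v => h v * k v) u = partial i h u * k u + h u * partial i k u.
Proof.
move=> dh dk; rewrite /partial deriveM; [|exact: diff_derivable..].
by rewrite addrC; congr (_ + _); exact: mulrC.
Qed.

Lemma partialZ (a : R) h i u : differentiable h u ->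
  partial i (fun v => a * h v) u = a * partial i h u.
Proof. by move=> dh; apply: deriveZ; exact: diff_derivable. Qed.

Lemma partial_sum m (F : 'I_m -> 'rV[R]_n -> R) i u :
  (forall l, differentiable (F l) u) ->
  partial i (fun v => \sum_(l < m) F l v) u = \sum_(l < m) partial i (F l) u.
Proof.
move=> dF; rewrite /partial -derive_sum; last by move=> l; exact: diff_derivable.
by congr derive; apply/funext => v; rewrite fct_sumE.
Qed.

Lemma differentiable_expR (x : R) : differentiable (expR : R -> R) x.
Proof. exact/derivable1_diffP/derivable_expR. Qed.

Lemma differentiable_expR_comp h u :
  differentiable h u -> differentiable (fun v => expR (h v)) u.
Proof. by move=> dh; apply: (differentiable_comp dh); exact: differentiable_expR. Qed.

Lemma partial_expR h i u : differentiable h u ->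
  partial i (fun v => expR (h v)) u = expR (h u) * partial i h u.
Proof.
move=> dh; have de := differentiable_expR (h u).
rewrite !partialE //; last exact: differentiable_expR_comp.
rewrite -[fun v => _]/(expR \o h) diff_comp //= diff1E //= derive1E.
by rewrite [X in _ *: X](congr1 (@^~ (h u)) (derive_expR R)); exact: mulrC.
Qed.

Lemma partialV h i u : differentiable h u -> h u != 0 ->
  partial i (fun v => (h v)^-1) u = - (h u)^-1 ^+ 2 * partial i h u.
Proof.
move=> dh h0; rewrite /partial deriveV //; last exact: diff_derivable.
by rewrite exprVn.
Qed.

End Partial.

Lemma partial_chain (R : realType) n m (T : 'rV[R]_n -> 'rV[R]_m) (h : 'rV[R]_m -> R) (i : 'I_n)
    (u : 'rV[R]_n) :
  (forall c, differentiable (fun v => T v 0 c) u) -> differentiable h (T u) ->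
  partial i (h \o T) u
    = \sum_(c < m) partial i (fun v => T v 0 c) u * partial c h (T u).
Proof.
move=> dT dh; have dT' := differentiable_rowP dT.
rewrite partialE; last exact: differentiable_comp.
rewrite diff_comp //= [X in 'd h _ X]row_sum_delta linear_sum.
apply: eq_bigr => c _; rewrite linearZ (partialE c dh); congr (_ * _).
rewrite /partial deriveE //.
rewrite -[fun v => T v 0 c]/((fun w : 'rV[R]_m => w 0 c) \o T).
rewrite (diff_comp dT' (differentiable_coord (T u) 0 c)) /=.
(* The coordinate projection is packaged as a linear map, so that it is its own differential. *)
have @f : {linear 'rV[R]_m -> R}.
  by exists (fun N : 'rV[R]_m => N 0 c); do 2![eexists]; do ?[constructor];
     rewrite ?mxE// => ? *; rewrite ?mxE//; move=> ?; rewrite !mxE.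
by rewrite (_ : (fun w : 'rV[R]_m => w 0 c) = f) // diff_lin //; exact: coord_continuous.
Qed.

(** With row vectors, the row index of the Jacobian is the direction of differentiation and the
    column index is the component. *)
Lemma jacobianE (R : realType) n m (T : 'rV[R]_n -> 'rV[R]_m) u (a : 'I_n) (c : 'I_m) :
  (forall c, differentiable (fun v => T v 0 c) u) ->
  ('J T u) a c = partial a (fun v => T v 0 c) u.
Proof.
move=> dT; have dT' := differentiable_rowP dT.
have := @deriveEjacobian R n m T u (delta_mx 0 a) dT'.
rewrite -rowE => /rowP /(_ c); rewrite mxE => <-.
rewrite derive_mx ?mxE //; exact: diff_derivable.
Qed.

(** * Smooth functions *)

Section Smooth.
Variables (R : realType) (n : nat) (U : set 'rV[R]_n).
Hypothesis oU : open U.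
Implicit Types (h k : 'rV[R]_n -> R) (u : 'rV[R]_n).

(** Smoothness is truncated at order [m] to allow induction on [m]: the derivative of a product, an
    exponential or an inverse contains the original functions again, but is needed only to one order
    less. *)
Definition smooth_upto (m : nat) h : Prop :=
  forall s : seq 'I_n, (size s <= m)%N -> forall u, U u ->
    differentiable (foldr (@partial R n) h s) u.

Lemma smooth_onE h : smooth_on U h <-> forall m, smooth_upto m h.
Proof.
by split=> [sh m s _|sh s]; [exact: sh|apply: (sh (size s))].
Qed.

Lemma smooth_upto_diff m h : smooth_upto m h -> {in U, forall u, differentiable h u}.
Proof. by move=> sh u; rewrite inE => Uu; exact: (sh [::]). Qed.

Lemma smooth_uptoS m h : smooth_upto m.+1 h <->
  {in U, forall u, differentiable h u} /\ (forall i, smooth_upto m (partial i h)).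
Proof.
split=> [sh|[dh sh] s].
  split=> [|i s sm u Uu]; first exact: smooth_upto_diff sh.
  by have := sh (rcons s i); rewrite size_rcons foldr_rcons; apply.
(* The last entry of the list is the derivative taken first, so peeling off that derivative means
   splitting [s] from the right. *)
case/lastP: s => [_ u Uu|s i]; first by apply: dh; rewrite inE.
by rewrite size_rcons foldr_rcons; exact: sh.
Qed.

Lemma smooth_uptoW m h : smooth_upto m.+1 h -> smooth_upto m h.
Proof. by move=> sh s sm; apply: sh; exact: leqW. Qed.

Lemma smooth_upto_eq m h k : {in U, h =1 k} -> smooth_upto m h -> smooth_upto m k.
Proof.
elim: m h k => [|m IH] h k hk sh.
  case=> //= _ u Uu; apply: (near_eq_differentiable (f := h)); last exact: (sh [::]).
  by apply: filterS (open_nbhs_nbhs (conj oU Uu)) => v Uv; apply: hk; rewrite inE.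
have [dh sdh] := (smooth_uptoS m h).1 sh; apply/smooth_uptoS; split=> [u uU|i].
  apply: (near_eq_differentiable (f := h)); last exact: dh.
  have Uu : U u by rewrite inE in uU.
  by apply: filterS (open_nbhs_nbhs (conj oU Uu)) => v Uv; apply: hk; rewrite inE.
by apply: IH (sdh i); exact: partial_eq_on.
Qed.

Lemma smooth_upto_cst m (a : R) : smooth_upto m (fun=> a).
Proof.
elim: m a => [|m IH] a; first by case=> //= _ u _; exact: differentiable_cst.
apply/smooth_uptoS; split=> [u _|i]; first exact: differentiable_cst.
by apply: smooth_upto_eq (IH 0) => u _; rewrite partial_cst.
Qed.

Lemma smooth_uptoD m h k : smooth_upto m h -> smooth_upto m k ->
  smooth_upto m (fun u => h u + k u).
Proof.
elim: m h k => [|m IH] h k sh sk.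
  by case=> //= _ u Uu; apply: differentiableD; [exact: (sh [::])|exact: (sk [::])].
have [dh sdh] := (smooth_uptoS m h).1 sh; have [dk sdk] := (smooth_uptoS m k).1 sk.
apply/smooth_uptoS; split=> [u uU|i].
  by apply: differentiableD; [exact: dh|exact: dk].
apply: smooth_upto_eq (IH _ _ (sdh i) (sdk i)) => u uU.
by rewrite partialD; [|exact: dh|exact: dk].
Qed.

Lemma smooth_uptoM m h k : smooth_upto m h -> smooth_upto m k ->
  smooth_upto m (fun u => h u * k u).
Proof.
elim: m h k => [|m IH] h k sh sk.
  by case=> //= _ u Uu; apply: differentiableM; [exact: (sh [::])|exact: (sk [::])].
have [dh sdh] := (smooth_uptoS m h).1 sh; have [dk sdk] := (smooth_uptoS m k).1 sk.
apply/smooth_uptoS; split=> [u uU|i].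
  by apply: differentiableM; [exact: dh|exact: dk].
apply: smooth_upto_eq (smooth_uptoD (IH _ _ (sdh i) (smooth_uptoW sk))
                                    (IH _ _ (smooth_uptoW sh) (sdk i))) => u uU.
by rewrite partialM; [|exact: dh|exact: dk].
Qed.

Lemma smooth_upto_expR m h : smooth_upto m h -> smooth_upto m (fun u => expR (h u)).
Proof.
elim: m h => [|m IH] h sh.
  by case=> //= _ u Uu; apply: differentiable_expR_comp; exact: (sh [::]).
have [dh sdh] := (smooth_uptoS m h).1 sh; apply/smooth_uptoS; split=> [u uU|i].
  by apply: differentiable_expR_comp; exact: dh.
apply: smooth_upto_eq (smooth_uptoM (IH _ (smooth_uptoW sh)) (sdh i)) => u uU.
by rewrite partial_expR //; exact: dh.
Qed.

Lemma smooth_uptoV m h : {in U, forall u, h u != 0} ->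
  smooth_upto m h -> smooth_upto m (fun u => (h u)^-1).
Proof.
move=> h0; elim: m => [|m IH] sh.
  case=> //= _ u Uu; apply: differentiableV; first exact: (sh [::]).
  by apply: h0; rewrite inE.
have [dh sdh] := (smooth_uptoS m h).1 sh; apply/smooth_uptoS; split=> [u uU|i].
  by apply: differentiableV; [exact: dh|exact: h0].
(* By induction [1/h] is smooth to order [m], and its derivative [- (1/h)^2 h'] is a product of
   functions smooth to that order. *)
have sV := IH (smooth_uptoW sh).
have sM := smooth_uptoM (smooth_uptoM (smooth_upto_cst (-1)) (smooth_uptoM sV sV))
  (sdh i).
apply: smooth_upto_eq sM => u uU.
by rewrite partialV ?h0 //; [rewrite mulN1r expr2|exact: dh].
Qed.

Lemma smooth_on_eq h k : {in U, h =1 k} -> smooth_on U h -> smooth_on U k.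
Proof.
by move=> hk /smooth_onE sh; apply/smooth_onE => m; exact: smooth_upto_eq hk (sh m).
Qed.

Lemma smooth_on_partial h i : smooth_on U h -> smooth_on U (partial i h).
Proof. by move=> sh s u Uu; rewrite -foldr_rcons; exact: sh. Qed.

Lemma smooth_on_cst (a : R) : smooth_on U (fun=> a).
Proof. by apply/smooth_onE => m; exact: smooth_upto_cst. Qed.

Lemma smooth_onD h k : smooth_on U h -> smooth_on U k -> smooth_on U (fun u => h u + k u).
Proof.
by move=> /smooth_onE sh /smooth_onE sk; apply/smooth_onE => m; exact: smooth_uptoD.
Qed.

Lemma smooth_onM h k : smooth_on U h -> smooth_on U k -> smooth_on U (fun u => h u * k u).
Proof.
by move=> /smooth_onE sh /smooth_onE sk; apply/smooth_onE => m; exact: smooth_uptoM.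
Qed.

Lemma smooth_onN h : smooth_on U h -> smooth_on U (fun u => - h u).
Proof.
move=> sh; apply: smooth_on_eq (smooth_onM (smooth_on_cst (-1)) sh) => u _.
by rewrite mulN1r.
Qed.

Lemma smooth_onB h k : smooth_on U h -> smooth_on U k -> smooth_on U (fun u => h u - k u).
Proof. by move=> sh sk; apply: smooth_onD (smooth_onN sk). Qed.

Lemma smooth_on_expR h : smooth_on U h -> smooth_on U (fun u => expR (h u)).
Proof.
by move=> /smooth_onE sh; apply/smooth_onE => m; exact: smooth_upto_expR.
Qed.

Lemma smooth_onV h : {in U, forall u, h u != 0} ->
  smooth_on U h -> smooth_on U (fun u => (h u)^-1).
Proof.
by move=> h0 /smooth_onE sh; apply/smooth_onE => m; exact: smooth_uptoV.
Qed.

Lemma smooth_on_sum (I : Type) (r : seq I) (F : I -> 'rV[R]_n -> R) :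
  (forall i, smooth_on U (F i)) -> smooth_on U (fun u => \sum_(i <- r) F i u).
Proof.
move=> sF; elim: r => [|i r IH].
  by under eq_fun do rewrite big_nil; exact: smooth_on_cst.
by under eq_fun do rewrite big_cons; exact: smooth_onD.
Qed.

Lemma smooth_on_prod (I : Type) (r : seq I) (F : I -> 'rV[R]_n -> R) :
  (forall i, smooth_on U (F i)) -> smooth_on U (fun u => \prod_(i <- r) F i u).
Proof.
move=> sF; elim: r => [|i r IH].
  by under eq_fun do rewrite big_nil; exact: smooth_on_cst.
by under eq_fun do rewrite big_cons; exact: smooth_onM.
Qed.

Lemma smooth_on_det m (A : 'rV[R]_n -> 'M[R]_m) :
  (forall i j, smooth_on U (fun u => A u i j)) -> smooth_on U (fun u => \det (A u)).
Proof.
move=> sA; apply: smooth_on_sum => s; apply: smooth_onM; first exact: smooth_on_cst.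
by apply: smooth_on_prod => i; exact: sA.
Qed.

Lemma smooth_on_mulmx m p q (A : 'rV[R]_n -> 'M[R]_(m, p)) (B : 'rV[R]_n -> 'M[R]_(p, q)) :
  (forall i j, smooth_on U (fun u => A u i j)) ->
  (forall i j, smooth_on U (fun u => B u i j)) ->
  forall i j, smooth_on U (fun u => (A u *m B u) i j).
Proof.
move=> sA sB i j; under eq_fun do rewrite mxE.
by apply: smooth_on_sum => l; exact: smooth_onM.
Qed.

(** Cramer's rule: the entries of the inverse are polynomials in the entries of [A], divided by the
    nonvanishing determinant. *)
Lemma smooth_on_invmx m (A : 'rV[R]_n -> 'M[R]_m) :
  {in U, forall u, A u \in unitmx} ->
  (forall i j, smooth_on U (fun u => A u i j)) ->
  forall i j, smooth_on U (fun u => invmx (A u) i j).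
Proof.
move=> uA sA i j.
apply: (smooth_on_eq (h := fun u => (\det (A u))^-1 * \adj (A u) i j)).
  by move=> u uU; rewrite /invmx (uA u uU) [RHS]mxE.
apply: smooth_onM.
  apply: smooth_onV; last exact: smooth_on_det.
  by move=> u uU; rewrite -unitfE -unitmxE; exact: uA.
under eq_fun do rewrite mxE.
apply: smooth_onM; first exact: smooth_on_cst.
by apply: smooth_on_det => a b; under eq_fun do rewrite !mxE; exact: sA.
Qed.

(** * Smoothness of the coordinate expressions built from a metric *)

Section Metric.
Variable g : 'rV[R]_n -> 'M[R]_n.
Hypothesis ug : {in U, forall u, g u \in unitmx}.
Hypothesis sg : forall i j, smooth_on U (fun u => g u i j).

Lemma smooth_on_christoffel l i j : smooth_on U (christoffel g l i j).
Proof.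
apply: smooth_onM; first exact: smooth_on_cst.
apply: smooth_on_sum => m; apply: smooth_onM; first exact: smooth_on_invmx.
by apply: smooth_onB; [apply: smooth_onD|]; exact: smooth_on_partial.
Qed.

Lemma smooth_on_ricci_mx i j : smooth_on U (fun u => ricci_mx g u i j).
Proof.
under eq_fun do rewrite mxE; apply: smooth_on_sum => l.
apply: smooth_onD.
  by apply: smooth_onB; apply: smooth_on_partial; exact: smooth_on_christoffel.
by apply: smooth_on_sum => m; apply: smooth_onB; apply: smooth_onM;
  exact: smooth_on_christoffel.
Qed.

Lemma smooth_on_lie_mx (Z : 'rV[R]_n -> 'rV[R]_n) i j :
  (forall l, smooth_on U (fun u => Z u 0 l)) -> smooth_on U (fun u => lie_mx Z g u i j).
Proof.
move=> sZ; under eq_fun do rewrite mxE; apply: smooth_on_sum => l.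
by apply: smooth_onD; [apply: smooth_onD|]; apply: smooth_onM => //;
  exact: smooth_on_partial.
Qed.

Lemma smooth_on_hess_mx h i j :
  smooth_on U h -> smooth_on U (fun u => hess_mx g h u i j).
Proof.
move=> sh; under eq_fun do rewrite mxE.
apply: smooth_onB; first by do 2 apply: smooth_on_partial.
apply: smooth_on_sum => l; apply: smooth_onM; first exact: smooth_on_christoffel.
exact: smooth_on_partial.
Qed.

Lemma smooth_on_diff_row h i : smooth_on U h -> smooth_on U (fun u => diff_row h u 0 i).
Proof. by move=> sh; under eq_fun do rewrite mxE; exact: smooth_on_partial. Qed.

Lemma smooth_on_trace_mx (S : 'rV[R]_n -> 'M[R]_n) :
  (forall i j, smooth_on U (fun u => S u i j)) ->
  smooth_on U (fun u => trace_mx (g u) (S u)).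
Proof.
move=> sS; apply: smooth_on_sum => i; apply: smooth_on_mulmx => //.
exact: smooth_on_invmx.
Qed.

End Metric.

End Smooth.

(** Freezing the last coordinates at [c] commutes with differentiation in the first [n1] directions,
    so each iterated derivative of the slice is the restriction of an iterated derivative of [h]. *)
Lemma smooth_on_slice (R : realType) (n1 n2 : nat) (U : set 'rV[R]_n1)
    (W : set 'rV[R]_(n1 + n2)) (c : 'rV[R]_n2) (h : 'rV[R]_(n1 + n2) -> R) :
  (forall u, U u -> W (row_mx u c)) -> smooth_on W h ->
  smooth_on U (fun u => h (row_mx u c)).
Proof.
move=> UW sh s u Uu.
have -> : foldr (@partial R n1) (fun v => h (row_mx v c)) s
        = (foldr (@partial R (n1 + n2)) h (map (lshift n2) s)) \o (row_mx ^~ c).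
  elim: s => //= i s ->; apply/funext => v; rewrite /partial /derive /=.
  suff -> : delta_mx 0 (lshift n2 i) = row_mx (delta_mx 0 i) 0 :> 'rV[R]_(n1 + n2).
    under [in RHS]eq_fun do rewrite scale_row_mx add_row_mx scaler0 add0r.
    by [].
  exact: delta_mx_lshift.
apply: (@differentiable_comp _ _ _ _ (row_mx ^~ c)); last by apply: sh; exact: UW.
apply: differentiable_rowP => k; case: (split_ordP k) => j ->.
  by under eq_fun do rewrite row_mxEl; exact: differentiable_coord.
by under eq_fun do rewrite row_mxEr; exact: differentiable_cst.
Qed.

(** * Symmetry of second derivatives *)

(** The difference quotient of a restriction to a line is the directional difference quotient, so a
    directional derivative becomes a one-variable derivative, to which the mean value theorem
    applies. *)
Lemma line_growth_rate (R : realType) (V W : normedModType R) (h : V -> W) (v w : V) (s : R) :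
  (fun t : R => t^-1 *: (((fun r : R => h (r *: v + w)) \o shift s) (t *: 1) - h (s *: v + w)))
  = (fun t : R => t^-1 *: ((h \o shift (s *: v + w)) (t *: v) - h (s *: v + w))).
Proof.
apply/funext => t; rewrite /= (_ : t *: 1 = t); last exact: mulr1.
by rewrite scalerDl addrA.
Qed.

Lemma is_derive_line (R : realType) (V W : normedModType R) (h : V -> W) (v w : V) (s : R) :
  derivable h (s *: v + w) v ->
  is_derive s 1 (fun r : R => h (r *: v + w)) ('D_v h (s *: v + w)).
Proof.
move=> dh; apply: DeriveDef.
  by rewrite /derivable (line_growth_rate h v w s); exact: dh.
by rewrite /derive (line_growth_rate h v w s).
Qed.

Lemma norm_delta_mx_le (R : realType) n (i : 'I_n) :
  `|delta_mx 0 i : 'rV[R]_n| <= 1.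
Proof.
rewrite [leLHS]/Num.Def.normr /= mx_normrE (bigmax_le _ ler01)//= => -[a b] _.
by rewrite mxE /=; case: (_ && _); rewrite ?normr1 ?normr0.
Qed.

(** The second difference is the increment over [[0, t]] of a one-variable function whose derivative
    is a difference of two values of [partial i h]. The mean value theorem and the first-order
    expansion of [partial i h] at [u] give the leading term [t^2] times the mixed derivative. *)
Lemma second_difference (R : realType) n (h : 'rV[R]_n -> R) (i j : 'I_n) (u : 'rV[R]_n) :
  (\near u, differentiable h u) -> differentiable (partial i h) u ->
  forall e, 0 < e -> \forall t \near (0 : R)^'+,
    `|h (t *: delta_mx 0 i + (t *: delta_mx 0 j + u)) - h (t *: delta_mx 0 i + u)
      - h (t *: delta_mx 0 j + u) + h u - t ^+ 2 * partial j (partial i h) u|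
    <= e * t ^+ 2.
Proof.
move=> dh dp e e0; set ei := delta_mx 0 i; set ej := delta_mx 0 j.
(* The expansion is used at points of norm at most [2t] and [t]; with tolerance [e / 3] the two
   errors add up to [e t]. *)
have e3 : 0 < e / 3 by rewrite divr_gt0.
have nei : `|ei| <= 1 by exact: norm_delta_mx_le.
have nej : `|ej| <= 1 by exact: norm_delta_mx_le.
have := (diff_locallyP u (partial i h)).1 dp => -[_ /eqaddoP /(_ _ e3)].
case/nbhs_ballP => d1 /= d10 hd1.
case/nbhs_ballP: dh => d2 /= d20 hd2.
have approx w : `|w| < d1 ->
    `|partial i h (w + u) - (partial i h u + 'd (partial i h) u w)| <= e / 3 * `|w|.
  by move=> wd; apply: hd1; rewrite -ball_normE /ball_ /= sub0r normrN.
pose d := Num.min d1 d2.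
have d0 : 0 < d by rewrite lt_min d10.
near=> t.
have t0 : 0 < t by near: t; exact: nbhs_right_gt.
have td : 2 * t < d.
  by rewrite mulrC -ltr_pdivlMr //; near: t; apply: nbhs_right_lt; rewrite divr_gt0.
have small s : 0 <= s -> s <= t -> `|s *: ei + t *: ej| <= 2 * t /\ `|s *: ei| <= t.
  move=> s0 st.
  have a1 : `|s *: ei| <= t.
    rewrite normrZ ger0_norm //; apply: (le_trans _ st); exact: ler_piMr.
  split=> //; apply: (le_trans (ler_normD _ _)); rewrite mulrDl mul1r.
  apply: lerD => //; rewrite normrZ (ger0_norm (ltW t0)).
  by apply: ler_piMr => //; exact: ltW.
have dhs w : `|w| < d2 -> differentiable h (w + u).
  move=> wd; apply: hd2; rewrite -ball_normE /ball_ /=.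
  by rewrite opprD addrCA subrr addr0 normrN.
(* [psi t - psi 0] is the second difference: a difference in direction [j], regarded as a function
   of the step [s] in direction [i]. *)
pose psi (s : R) := h (s *: ei + (t *: ej + u)) - h (s *: ei + u).
pose dpsi (s : R) := partial i h (s *: ei + (t *: ej + u)) - partial i h (s *: ei + u).
have dpsiP s : 0 <= s -> s <= t -> is_derive s 1 psi (dpsi s).
  move=> s0 st; have [n1 n2] := small _ s0 st.
  apply: is_deriveB; apply: is_derive_line; apply: diff_derivable.
    rewrite addrA; apply: dhs; apply: le_lt_trans n1 _; apply: lt_le_trans td _.
    by rewrite ge_min lexx orbT.
  apply: dhs; apply: le_lt_trans n2 _; apply: lt_le_trans (_ : d <= d2).
    by apply: le_lt_trans td; rewrite ler_peMl ?(ltW t0) // ler1n.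
  by rewrite ge_min lexx orbT.
have [c] : exists2 c, c \in `]0, t[%R & psi t - psi 0 = dpsi c * (t - 0).
  apply: MVT => // [s|].
    by rewrite in_itv /= => /andP[s0 st]; apply: dpsiP; exact: ltW.
  apply: derivable_within_continuous => s; rewrite in_itv /= => /andP[s0 st].
  by have [] := dpsiP _ s0 st.
rewrite in_itv /= subr0 => /andP[c0 ct] mvt.
have [n1 n2] := small _ (ltW c0) (ltW ct).
have -> : h (t *: ei + (t *: ej + u)) - h (t *: ei + u) - h (t *: ej + u) + h u
    = dpsi c * t.
  by rewrite -mvt /psi !scale0r !add0r; ring.
have d1d : d <= d1 by rewrite ge_min lexx.
have A1 : `|c *: ei + t *: ej| < d1 by apply: le_lt_trans n1 _; exact: lt_le_trans td _.
have A2 : `|c *: ei| < d1.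
  apply: le_lt_trans n2 _; apply: lt_le_trans d1d; apply: le_lt_trans td.
  by rewrite ler_peMl ?(ltW t0) // ler1n.
have := approx _ A1; have := approx _ A2.
have dZ a i' : 'd (partial i h) u (a *: delta_mx 0 i') = a * partial i' (partial i h) u.
  by rewrite (partialE i' dp); exact: linearZ.
have dD w1 w2 : 'd (partial i h) u (w1 + w2) = 'd (partial i h) u w1 + 'd (partial i h) u w2.
  exact: linearD.
rewrite /dpsi addrA dD !dZ => B2 B1.
set P1 := partial i h (_ + _ + _) in B1 *; set P2 := partial i h (_ + u) in B2 *.
set L := partial i (partial i h) u in B1 B2; set M := partial j _ u in B1 *.
set P := partial i h u in B1 B2.
have C1 : `|P1 - (P + (c * L + t * M))| <= e / 3 * (2 * t).
  by apply: le_trans B1 _; apply: ler_wpM2l => //; exact: ltW.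
have C2 : `|P2 - (P + c * L)| <= e / 3 * t.
  by apply: le_trans B2 _; apply: ler_wpM2l => //; exact: ltW.
(* The terms [P] and [c L] of the two expansions cancel, so the unknown intermediate point [c]
   disappears from the leading term. *)
have -> : (P1 - P2) * t - t ^+ 2 * M =
    t * ((P1 - (P + (c * L + t * M))) - (P2 - (P + c * L))).
  by ring.
rewrite normrM gtr0_norm // [e * _](_ : _ = t * (e / 3 * (2 * t) + e / 3 * t)); last by field.
rewrite ler_pM2l //; apply: le_trans (ler_normB _ _) _; exact: lerD.
Unshelve. all: by end_near. Qed.

(** Young's form of the symmetry theorem: the second difference [D] is symmetric in the two
    directions, and [D / t^2] is within [e / 2] of either mixed derivative for small [t]. *)
Lemma partialC (R : realType) n (h : 'rV[R]_n -> R) (i j : 'I_n) (u : 'rV[R]_n) :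
  (\near u, differentiable h u) -> differentiable (partial i h) u ->
  differentiable (partial j h) u ->
  partial i (partial j h) u = partial j (partial i h) u.
Proof.
move=> dh dpi dpj; apply/eqP; rewrite -subr_eq0 -normr_le0; apply/ler_addgt0Pr => e e0.
rewrite add0r; have e2 : 0 < e / 2 by rewrite divr_gt0.
have Sij := second_difference j dh dpi e2.
have Sji := second_difference i dh dpj e2.
have [t [[]]] := filter_ex (filterI (filterI Sij Sji) (nbhs_right_gt (0 : R))).
(* Reordering the summands makes the second difference taken in the order [j], [i] syntactically the
   one taken in the order [i], [j]. *)
rewrite [t *: delta_mx 0 j + (_ + _)]addrCA (addrAC (h _) (- h (t *: delta_mx 0 j + u))).
move: (h _ - h _ - h _ + h u) (partial i _ u) (partial j _ u) => D p q B1 B2 /= t0.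
have t20 : 0 < t ^+ 2 by rewrite exprn_gt0.
rewrite -(ler_pM2l t20) -{1}(gtr0_norm t20) -normrM.
have -> : t ^+ 2 * (p - q) = (D - t ^+ 2 * q) - (D - t ^+ 2 * p) by ring.
apply: le_trans (ler_normB _ _) _; apply: le_trans (lerD B1 B2) _.
by rewrite -mulrDl -splitr mulrC.
Qed.

(** * Conformal change and change of chart for Hessians *)

Lemma smooth_on_partialC (R : realType) n (U : set 'rV[R]_n) (h : 'rV[R]_n -> R)
    (i j : 'I_n) (u : 'rV[R]_n) : open U -> smooth_on U h -> U u ->
  partial i (partial j h) u = partial j (partial i h) u.
Proof.
move=> oU sh Uu; apply: partialC; [|exact: (sh [:: i])|exact: (sh [:: j])].
by apply: filterS (open_nbhs_nbhs (conj oU Uu)) => v Uv; exact: (sh [::]).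
Qed.

Section HessianOfScalar.
Variables (R : realType) (n : nat).
Implicit Types (g : 'rV[R]_n -> 'M[R]_n) (h k s : 'rV[R]_n -> R) (u : 'rV[R]_n).

(** The inverse metric in the Christoffel symbols is absorbed into the gradient of [h]. What remains
    involves only first derivatives of [g], which is convenient under conformal changes and changes
    of chart. *)
Lemma hess_mxE g h u i j :
  hess_mx g h u i j = partial i (partial j h) u
    - 2^-1 * \sum_l (partial i (fun v => g v j l) u + partial j (fun v => g v i l) u
                     - partial l (fun v => g v i j) u) * grad_row g h u 0 l.
Proof.
rewrite mxE; congr (_ - _); rewrite /christoffel.
under eq_bigr do rewrite -mulrA mulr_suml.
rewrite -mulr_sumr exchange_big; congr (_ * _); apply: eq_bigr => l _.
rewrite mxE mulr_sumr; apply: eq_bigr => m _; rewrite !mxE; ring.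
Qed.

Lemma diff_rowD h k u : differentiable h u -> differentiable k u ->
  diff_row (fun v => h v + k v) u = diff_row h u + diff_row k u.
Proof. by move=> dh dk; apply/rowP => i; rewrite !mxE partialD. Qed.

Lemma grad_rowD g h k u : differentiable h u -> differentiable k u ->
  grad_row g (fun v => h v + k v) u = grad_row g h u + grad_row g k u.
Proof. by move=> dh dk; rewrite /grad_row diff_rowD // mulmxDl. Qed.

Lemma hess_mxD (U : set 'rV[R]_n) g h k u : open U -> smooth_on U h -> smooth_on U k ->
  U u -> hess_mx g (fun v => h v + k v) u = hess_mx g h u + hess_mx g k u.
Proof.
move=> oU sh sk Uu; apply/matrixP => i j; rewrite [RHS]mxE !hess_mxE.
rewrite grad_rowD; [|exact: (sh [::])|exact: (sk [::])].
have -> : partial i (partial j (fun v => h v + k v)) u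
  = partial i (fun v => partial j h v + partial j k v) u.
  apply: (partial_eq_on i oU); last by rewrite inE.
  by move=> v; rewrite inE => Uv; rewrite partialD //; [exact: (sh [::])|exact: (sk [::])].
rewrite partialD; [|exact: (sh [:: j])|exact: (sk [:: j])].
under eq_bigr do rewrite mxE mulrDr.
by rewrite big_split /= mulrDr opprD addrACA.
Qed.

Lemma grad_row_lower g h u j : (g u)^T = g u -> g u \in unitmx ->
  \sum_l g u j l * grad_row g h u 0 l = partial j h u.
Proof.
move=> gT gu; have := mulmxKV gu (diff_row h u) => /rowP /(_ j).
rewrite /grad_row !mxE => <-; apply: eq_bigr => l _; rewrite mulrC; congr (_ * _).
by rewrite -[in RHS]gT mxE.
Qed.

Lemma grad_row_conformal g h s u : g u \in unitmx ->
  grad_row (fun v => expR (2 * s v) *: g v) h u = (expR (2 * s u))^-1 *: grad_row g h u.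
Proof.
move=> gu; rewrite /grad_row invmxZ //; first by rewrite -scalemxAr.
by rewrite unitmxZ // unitfE expR_eq0.
Qed.

(** The factor [e^{2s}] in the derivatives of the metric cancels [e^{-2s}] in the gradient.
    Differentiating the exponent leaves three corrections: in two of them the metric lowers the
    gradient to [dh], in the third the gradient is paired with [ds]. *)
Lemma hess_mx_conformal g h s u :
  (g u)^T = g u -> g u \in unitmx -> differentiable s u ->
  (forall i j, differentiable (fun v => g v i j) u) ->
  hess_mx (fun v => expR (2 * s v) *: g v) h u
  = hess_mx g h u - ((diff_row s u)^T *m diff_row h u + (diff_row h u)^T *m diff_row s u)
    + (grad_row g h u *m (diff_row s u)^T) 0 0 *: g u.
Proof.
move=> gT gu ds dg; apply/matrixP => i j.
have d2s : differentiable (fun v => 2 * s v) u by apply: differentiableZ.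
have pG a b c : partial a (fun v => (expR (2 * s v) *: g v) b c) u
    = expR (2 * s u) * (2 * partial a s u * g u b c + partial a (fun v => g v b c) u).
  under eq_fun do rewrite mxE.
  rewrite partialM //; last exact: differentiable_expR_comp.
  by rewrite partial_expR // partialZ //; ring.
rewrite hess_mxE grad_row_conformal //.
move: (hess_mxE g h u i j) (grad_row_lower h i gT gu) (grad_row_lower h j gT gu).
move: (hess_mx g h u) (grad_row g h u) => Hs X HsE Xi Xj.
rewrite ![in RHS]mxE !big_ord1 HsE !mxE -Xi -Xj.
have e0 : expR (2 * s u) != 0 by rewrite expR_eq0.
rewrite -[RHS]addrA -[RHS]addrA; congr (_ + _).
(* The last summand is the Christoffel contribution of [g] itself; the other three come from the
   derivative of [e^{2s}]. *)
rewrite (eq_bigr (fun l => 2 * partial i s u * (g u j l * X 0 l)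
   + 2 * partial j s u * (g u i l * X 0 l) - 2 * g u i j * (X 0 l * partial l s u)
   + (partial i (fun v => g v j l) u + partial j (fun v => g v i l) u
                     - partial l (fun v => g v i j) u) * X 0 l)); last first.
  move=> l _; rewrite !pG mxE.
  move: (partial i s u) (partial j s u) (partial l s u) (expR _) e0 => p q r e e0.
  move: (partial i _ u) (partial j _ u) (partial l _ u) => A B C.
  by move: (g u j l) (g u i l) (g u i j) (X 0 l) => a b c x; field.
rewrite !big_split /= -!mulr_sumr sumrN -mulr_sumr.
have -> : \sum_l X 0 l * (diff_row s u)^T l 0 = \sum_l X 0 l * partial l s u.
  by apply: eq_bigr => l _; rewrite !mxE.
by move: (\sum_l (_ + _ - _) * _) => C; field.
Qed.

End HessianOfScalar.

Lemma inner_grad_row (R : realType) n (g : 'rV[R]_n -> 'M[R]_n) (h k : 'rV[R]_n -> R) u :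
  (g u)^T = g u -> g u \in unitmx ->
  inner_mx (g u) (grad_row g h u) (grad_row g k u)
  = (grad_row g h u *m (diff_row k u)^T) 0 0.
Proof.
move=> gT gu; rewrite /inner_mx {2}/grad_row trmx_mul trmx_inv gT -!mulmxA.
by rewrite [g u *m _]mulmxA mulmxV // mul1mx.
Qed.

(* The left-hand side is F^-1 Hess F for the metric e^{2s} g and F = e^{k+s}. *)
Lemma hess_mx_warping (R : realType) n (U : set 'rV[R]_n) (g : 'rV[R]_n -> 'M[R]_n)
    (k s : 'rV[R]_n -> R) (u : 'rV[R]_n) :
  open U -> U u -> smooth_on U k -> smooth_on U s ->
  (forall i j, smooth_on U (fun v => g v i j)) -> (g u)^T = g u -> g u \in unitmx ->
  let w := fun v => k v + s v in
  hess_mx (fun v => expR (2 * s v) *: g v) w u + (diff_row w u)^T *m diff_row w u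
  = hess_mx g k u + (diff_row k u)^T *m diff_row k u
    + hess_mx g s u - (diff_row s u)^T *m diff_row s u
    + (inner_mx (g u) (grad_row g k u) (grad_row g s u)
       + inner_mx (g u) (grad_row g s u) (grad_row g s u)) *: g u.
Proof.
move=> oU Uu sk ss sg gT gu w.
have dk : differentiable k u by exact: (sk [::]).
have ds : differentiable s u by exact: (ss [::]).
rewrite hess_mx_conformal //; last by move=> i j; exact: (sg i j [::]).
rewrite (hess_mxD g oU sk ss Uu) diff_rowD // grad_rowD // mulmxDl [X in X *: _]mxE.
rewrite !inner_grad_row // [(_ + _)^T]linearD /= !mulmxDl !mulmxDr.
(* With [dw = dk + ds] the mixed terms cancel: [dw dw - ds dw - dw ds = dk dk - ds ds]. This is the
   origin of the minus sign in the obstruction tensor. *)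
move: (hess_mx g k u) (hess_mx g s u) (_ *: g u) => A B C.
move: (_ *m diff_row s u) (_ *m diff_row k u) => D E.
move: (_ *m diff_row s u) (_ *m diff_row k u) => F G.
apply/matrixP => i j; rewrite !mxE; ring.
Qed.

(** * The tensor law of the Hessian as matrix algebra *)

Section ChartChangeAlgebra.
Variables (R : realType) (n : nat) (J G Hp : 'M[R]_n) (dJ dG dg : 'I_n -> 'M[R]_n).
Variables (X X' dh' : 'rV[R]_n).
Hypothesis dJC : forall a b c, dJ a b c = dJ b a c.
Hypothesis dgE : forall a, dg a = dJ a *m G *m J^T
  + J *m (\sum_e J a e *: dG e) *m J^T + J *m G *m (dJ a)^T.
Hypothesis XJ : X *m J = X'.
Hypothesis X'G : X' *m G = dh'.
Hypothesis GT : G^T = G.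

(** [D] and [M'] are the derivatives of the Jacobian and of the metric along the gradient, and [N]
    contracts a metric index of the differentiated metric with the gradient. All first-order terms
    are expressed through these three. *)
Let D := \sum_l X 0 l *: dJ l.
Let N : 'M[R]_n := \matrix_(c, d) (dG c *m X'^T) d 0.
Let M' := \sum_e X' 0 e *: dG e.

(** Symmetry of the second derivatives of the transition map moves the contraction with [X] onto the
    differentiation index, which produces [D]. *)
Let XdJ a b : (J *m G *m (X *m dJ a)^T) b 0 = (J *m G *m D^T) b a.
Proof.
rewrite mxE [RHS]mxE; apply: eq_bigr => c _; congr (_ * _).
rewrite mxE [RHS]mxE mxE summxE; apply: eq_bigr => l _; rewrite [RHS]mxE dJC.
by [].
Qed.

Let JNJ a b : (J *m (\sum_e J a e *: dG e) *m X'^T) b 0 = (J *m N *m J^T) a b.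
Proof.
rewrite -mulmxA mxE [RHS]mxE; apply: eq_bigr => d _.
rewrite [J^T _ _]mxE mulrC; congr (_ * _); rewrite mulmx_suml summxE [RHS]mxE.
by apply: eq_bigr => c _; rewrite -scalemxAl [LHS]mxE [N _ _]mxE.
Qed.

Let GX' : G *m X'^T = dh'^T.
Proof. by rewrite -[in LHS]GT -trmx_mul X'G. Qed.

Let dgX a b : \sum_l dg a b l * X 0 l = (dJ a *m dh'^T) b 0
  + (J *m N *m J^T) a b + (J *m G *m D^T) b a.
Proof.
transitivity ((dg a *m X^T) b 0).
  by rewrite [RHS]mxE; apply: eq_bigr => l _; rewrite [X^T _ _]mxE.
have JX : J^T *m X^T = X'^T by rewrite -trmx_mul XJ.
rewrite dgE !mulmxDl -(mulmxA _ J^T) JX -(mulmxA (dJ a)) GX'.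
rewrite -(mulmxA _ J^T) JX -(mulmxA _ (dJ a)^T) -trmx_mul.
by rewrite mxE [X in X + _ = _]mxE JNJ XdJ.
Qed.

Let Xdg a b : \sum_l X 0 l * dg l a b = (J *m G *m D^T) b a
  + (J *m M' *m J^T) a b + (J *m G *m D^T) a b.
Proof.
transitivity ((\sum_l X 0 l *: dg l) a b).
  by rewrite summxE; apply: eq_bigr => l _; rewrite [RHS]mxE.
have -> : \sum_l X 0 l *: dg l = D *m G *m J^T + J *m M' *m J^T + J *m G *m D^T.
  have -> : M' = \sum_l X 0 l *: (\sum_e J l e *: dG e).
    under [RHS]eq_bigr do rewrite scaler_sumr.
    rewrite exchange_big /=; apply: eq_bigr => e _; rewrite -XJ.
    by rewrite mxE scaler_suml; apply: eq_bigr => l _; rewrite scalerA.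
  have -> : D *m G *m J^T = \sum_l X 0 l *: (dJ l *m G *m J^T).
    by rewrite 2!mulmx_suml; apply: eq_bigr => l _; rewrite -2!scalemxAl.
  have -> : J *m (\sum_l X 0 l *: (\sum_e J l e *: dG e)) *m J^T
      = \sum_l X 0 l *: (J *m (\sum_e J l e *: dG e) *m J^T).
    by rewrite mulmx_sumr mulmx_suml; apply: eq_bigr => l _; rewrite -scalemxAr -scalemxAl.
  have -> : J *m G *m D^T = \sum_l X 0 l *: (J *m G *m (dJ l)^T).
    by rewrite linear_sum mulmx_sumr; apply: eq_bigr => l _; rewrite linearZ scalemxAr.
  by rewrite -!big_split /=; apply: eq_bigr => l _; rewrite dgE !scalerDr.
rewrite mxE [X in X + _ = _]mxE; congr (_ + _ + _).
by rewrite -[in LHS](trmxK (D *m _ *m _)) mxE !trmx_mul trmxK GT mulmxA.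
Qed.

Let hess := \matrix_(c, d) (Hp c d
  - 2^-1 * \sum_l (dG c d l + dG d c l - dG l c d) * X' 0 l).

(** In the Koszul combination of the [dg] the terms with [D] cancel in pairs. The two terms with
    [dJ] and [dh'] coincide by symmetry of [dJ], and half their sum cancels the inhomogeneous term
    of the second derivative of the function. *)
Lemma hess_chart_change_entry a b :
  (dJ a *m dh'^T) b 0 + (J *m Hp *m J^T) a b
  - 2^-1 * \sum_l (dg a b l + dg b a l - dg l a b) * X 0 l
  = (J *m hess *m J^T) a b.
Proof.
have -> : hess = Hp - 2^-1 *: (N + N^T - M').
  apply/matrixP => c d; rewrite /N /M' !mxE; congr (_ - _ * _).
  rewrite summxE -big_split -sumrB /=; apply: eq_bigr => l _.
  by rewrite !mxE; ring.
rewrite mulmxBr mulmxBl -scalemxAr -scalemxAl !(mulmxBr, mulmxBl, mulmxDr, mulmxDl).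
have -> : \sum_l (dg a b l + dg b a l - dg l a b) * X 0 l
  = \sum_l dg a b l * X 0 l + \sum_l dg b a l * X 0 l - \sum_l X 0 l * dg l a b.
  rewrite -big_split -sumrB /=; apply: eq_bigr => l _.
  by rewrite mulrBl mulrDl [X 0 l * _]mulrC.
rewrite !dgX Xdg.
have -> : (dJ b *m dh'^T) a 0 = (dJ a *m dh'^T) b 0.
  by rewrite mxE [RHS]mxE; apply: eq_bigr => c _; rewrite dJC.
have -> : (J *m N *m J^T) b a = (J *m N^T *m J^T) a b.
  by rewrite -[in LHS](trmxK (J *m N *m _)) mxE !trmx_mul trmxK mulmxA.
move: (J *m Hp *m _) (J *m N *m _) (J *m N^T *m _) (J *m M' *m _) (J *m G *m _) (dJ a *m _).
by move=> A B C E F K; rewrite !mxE; field.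
Qed.

End ChartChangeAlgebra.

(** * Differential, gradient and Hessian under a change of chart *)

Section ChartChange.
Variables (R : realType) (n : nat) (V V' : set 'rV[R]_n) (T : 'rV[R]_n -> 'rV[R]_n).
Variables (g g' : 'rV[R]_n -> 'M[R]_n) (h h' : 'rV[R]_n -> R) (u : 'rV[R]_n).
Hypothesis oV : open V.
Hypothesis TV : forall v, V v -> V' (T v).
Hypothesis sT : forall c, smooth_on V (fun v => T v 0 c).
Hypothesis hT : forall v, V v -> h v = h' (T v).
Hypothesis sh' : smooth_on V' h'.
Hypothesis Vu : V u.

Let J v := 'J T v.

Let dT v c : V v -> differentiable (fun w => T w 0 c) v.
Proof. by move=> Vv; exact: (sT c [::]). Qed.

Let JE v a c : V v -> J v a c = partial a (fun w => T w 0 c) v.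
Proof. by move=> Vv; apply: jacobianE => d; exact: dT. Qed.

Let pull_partial v a : V v -> partial a h v = \sum_c J v a c * partial c h' (T v).
Proof.
move=> Vv; rewrite (partial_eq_on (k := h' \o T) a oV); last 2 first.
- by move=> w; rewrite inE => Vw; exact: hT.
- by rewrite inE.
rewrite partial_chain; last 2 first.
- by move=> c; exact: dT.
- by apply: (sh' [::]); exact: TV.
by apply: eq_bigr => c _; rewrite JE.
Qed.

Lemma diff_row_chart_change : diff_row h u = diff_row h' (T u) *m ('J T u)^T.
Proof.
apply/rowP => a; rewrite !mxE pull_partial //.
by apply: eq_bigr => c _; rewrite !mxE mulrC.
Qed.

Hypothesis gT : forall v, V v -> g v = 'J T v *m g' (T v) *m ('J T v)^T.
Hypothesis ug : g u \in unitmx.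
Hypothesis ug' : g' (T u) \in unitmx.

(** The transformation law exhibits the invertible matrix [g u] as a product with the Jacobian as a
    factor. *)
Lemma jacobian_unitmx : 'J T u \in unitmx.
Proof. by move: ug; rewrite gT // !unitmx_mul => /andP[/andP[]]. Qed.

Lemma grad_row_chart_change : grad_row g h u *m 'J T u = grad_row g' h' (T u).
Proof.
have uJ := jacobian_unitmx; have uJT : ('J T u)^T \in unitmx by rewrite unitmx_tr.
have gradK : grad_row g h u *m g u = diff_row h u by exact: mulmxKV.
rewrite -[LHS](mulmxK ug'); congr (_ *m _).
apply: (can_inj (mulmxK uJT)).
by rewrite -diff_row_chart_change -gradK gT // !mulmxA.
Qed.

Hypothesis sg' : forall i j, smooth_on V' (fun v => g' v i j).
Hypothesis g'T : (g' (T u))^T = g' (T u).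

Let dP a c : differentiable (partial a (fun w => T w 0 c)) u.
Proof. exact: (sT c [:: a]). Qed.

Let dg'T c d : differentiable (fun v => g' (T v) c d) u.
Proof.
apply: (@differentiable_comp _ _ _ _ T (fun w => g' w c d)).
  by apply: differentiable_rowP => e; exact: dT.
by apply: (sg' c d [::]); exact: TV.
Qed.

Let P b c v := partial b (fun w => T w 0 c) v.

Let partial_metric a b c : partial a (fun w => g w b c) u
  = \sum_d \sum_e (partial a (P b e) u * g' (T u) e d * J u c d
    + J u b e * (\sum_f J u a f * partial f (fun w => g' w e d) (T u)) * J u c d
    + J u b e * g' (T u) e d * partial a (P c d) u).
Proof.
have dPg b' c' d' e : differentiable (fun v => P b' e v * g' (T v) e d' * P c' d' v) u.
  by apply: differentiableM; [apply: differentiableM|exact: dP]; [exact: dP|].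
rewrite (partial_eq_on (k := fun v =>
  \sum_d \sum_e P b e v * g' (T v) e d * P c d v) a oV); last 2 first.
- move=> v; rewrite inE => Vv; rewrite gT // mxE; apply: eq_bigr => d _.
  rewrite mxE mulr_suml; apply: eq_bigr => e _.
  by rewrite [_^T _ _]mxE (JE b e Vv) (JE c d Vv).
- by rewrite inE.
rewrite partial_sum; last first.
  move=> d; have -> : (fun v => \sum_e P b e v * g' (T v) e d * P c d v)
      = \sum_e (fun v => P b e v * g' (T v) e d * P c d v).
    by apply/funext => v; rewrite fct_sumE.
  by apply: differentiable_sum => e.
apply: eq_bigr => d _; rewrite partial_sum //; apply: eq_bigr => e _.
rewrite partialM; [|by apply: differentiableM; [exact: dP|]|exact: dP].
rewrite partialM; [|exact: dP|by []].
rewrite (partial_chain a (h := fun w => g' w e d)); last 2 first.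
- by move=> f; exact: dT.
- by apply: (sg' e d [::]); exact: TV.
rewrite (JE b e Vu) (JE c d Vu) mulrDl; congr (_ + _ * _ + _); congr (_ * _).
by apply: eq_bigr => f _; rewrite JE.
Qed.

Let partial_partial a b : partial a (partial b h) u
  = \sum_c (partial a (P b c) u * partial c h' (T u)
             + J u b c * \sum_e J u a e * partial e (partial c h') (T u)).
Proof.
rewrite (partial_eq_on (k := fun v => \sum_c P b c v * partial c h' (T v)) a oV);
  last 2 first.
- move=> v; rewrite inE => Vv; rewrite pull_partial //.
  by apply: eq_bigr => c _; rewrite JE.
- by rewrite inE.
have dph' c : differentiable (fun v => partial c h' (T v)) u.
  apply: (@differentiable_comp _ _ _ _ T (partial c h')).
    by apply: differentiable_rowP => e; exact: dT.
  by apply: (sh' [:: c]); exact: TV.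
rewrite partial_sum; last by move=> c; apply: differentiableM => //; exact: dP.
apply: eq_bigr => d _; rewrite partialM //; last exact: dP.
rewrite (JE b d Vu); congr (_ + _ * _).
rewrite (partial_chain a (h := partial d h')); last 2 first.
- by move=> f; exact: dT.
- by apply: (sh' [:: d]); exact: TV.
by apply: eq_bigr => c _; rewrite JE.
Qed.

Lemma hess_mx_chart_change :
  hess_mx g h u = 'J T u *m hess_mx g' h' (T u) *m ('J T u)^T.
Proof.
apply/matrixP => a b.
pose dJ a : 'M[R]_n := \matrix_(b, c) partial a (P b c) u.
pose dG e : 'M[R]_n := \matrix_(c, d) partial e (fun w => g' w c d) (T u).
pose dg a : 'M[R]_n := \matrix_(b, c) partial a (fun w => g w b c) u.
pose Hp : 'M[R]_n := \matrix_(c, d) partial c (partial d h') (T u).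
have dJE x y z : dJ x y z = partial x (P y z) u.
  by rewrite mxE.
(* Symmetry of second derivatives, applied to the components of the transition map. *)
have PC x y z : partial x (P y z) u = partial y (P x z) u.
  exact: (smooth_on_partialC x y oV (sT z) Vu).
have dJC x y z : dJ x y z = dJ y x z.
  exact: etrans (dJE x y z) (etrans (PC x y z) (esym (dJE y x z))).
have dgE x : dg x = dJ x *m g' (T u) *m (J u)^T
  + J u *m (\sum_e J u x e *: dG e) *m (J u)^T + J u *m g' (T u) *m (dJ x)^T.
  apply/matrixP => y z; rewrite [LHS]mxE partial_metric.
  have mul3 (A B C : 'M[R]_n) : (A *m B *m C) y z = \sum_d \sum_e A y e * B e d * C d z.
    by rewrite mxE; apply: eq_bigr => d _; rewrite mxE mulr_suml.
  rewrite mxE [X in _ = X + _]mxE !mul3 -!big_split /=; apply: eq_bigr => d _.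
  rewrite -!big_split /=; apply: eq_bigr => e _; rewrite dJE.
  rewrite [(J u)^T _ _]mxE [(dJ x)^T _ _]mxE dJE summxE.
  congr (_ + _ * _ * _ + _); apply: eq_bigr => f _.
  by rewrite [RHS]mxE [dG f _ _]mxE.
have E := hess_chart_change_entry Hp dJC dgE grad_row_chart_change
  (mulmxKV ug' (diff_row h' (T u))) g'T a b.
rewrite hess_mxE partial_partial.
have -> : hess_mx g' h' (T u) = \matrix_(c, d) (Hp c d
  - 2^-1 * \sum_l (dG c d l + dG d c l - dG l c d) * grad_row g' h' (T u) 0 l).
  apply/matrixP => c d; rewrite hess_mxE [RHS]mxE [Hp _ _]mxE; congr (_ - _ * _).
  by apply: eq_bigr => l _; rewrite [dG c _ _]mxE [dG d _ _]mxE [dG l _ _]mxE.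
rewrite -{}E; congr (_ - _ * _); last first.
  by apply: eq_bigr => l _; rewrite [dg a _ _]mxE [dg b _ _]mxE [dg l _ _]mxE.
rewrite mxE [X in _ = _ + X]mxE -big_split /=; apply: eq_bigr => c _.
rewrite dJE [_^T _ _]mxE [diff_row _ _ _ _]mxE; congr (_ + _).
rewrite [(J u)^T _ _]mxE mulrC; congr (_ * _); rewrite mxE.
by apply: eq_bigr => e _; rewrite [Hp _ _]mxE.
Qed.

End ChartChange.

(** * Warped products in coordinates *)

Section SubmxPartial.
Variables (R : realType) (n1 n2 : nat).
Implicit Type u : 'rV[R]_(n1 + n2).

Let lsubmx_line (t : R) (a : 'rV[R]_n1) (b : 'rV[R]_n2) u :
  lsubmx (t *: row_mx a b + u) = t *: a + lsubmx u.
Proof. by rewrite linearD linearZ /= row_mxKl. Qed.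

Let rsubmx_line (t : R) (a : 'rV[R]_n1) (b : 'rV[R]_n2) u :
  rsubmx (t *: row_mx a b + u) = t *: b + rsubmx u.
Proof. by rewrite linearD linearZ /= row_mxKr. Qed.

Lemma partial_lsubmx_lshift (F : 'rV[R]_n1 -> R) i u :
  partial (lshift n2 i) (fun v => F (lsubmx v)) u = partial i F (lsubmx u).
Proof.
rewrite /partial /derive /= delta_mx_lshift.
by under eq_fun do rewrite lsubmx_line.
Qed.

Lemma partial_lsubmx_rshift (F : 'rV[R]_n1 -> R) a u :
  partial (rshift n1 a) (fun v => F (lsubmx v)) u = 0.
Proof.
rewrite -(derive0 F (lsubmx u)) /partial /derive /= delta_mx_rshift.
by under eq_fun do rewrite lsubmx_line.
Qed.

Lemma partial_rsubmx_rshift (F : 'rV[R]_n2 -> R) a u :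
  partial (rshift n1 a) (fun v => F (rsubmx v)) u = partial a F (rsubmx u).
Proof.
rewrite /partial /derive /= delta_mx_rshift.
by under eq_fun do rewrite rsubmx_line.
Qed.

Lemma partial_rsubmx_lshift (F : 'rV[R]_n2 -> R) i u :
  partial (lshift n2 i) (fun v => F (rsubmx v)) u = 0.
Proof.
rewrite -(derive0 F (rsubmx u)) /partial /derive /= delta_mx_lshift.
by under eq_fun do rewrite rsubmx_line.
Qed.

Lemma differentiable_comp_lsubmx (F : 'rV[R]_n1 -> R) u :
  differentiable F (lsubmx u) -> differentiable (fun v : 'rV[R]_(n1 + n2) => F (lsubmx v)) u.
Proof.
move=> dF; apply: (@differentiable_comp _ _ _ _ lsubmx F) => //.
exact: differentiable_lsubmx.
Qed.

Lemma differentiable_comp_rsubmx (F : 'rV[R]_n2 -> R) u :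
  differentiable F (rsubmx u) -> differentiable (fun v : 'rV[R]_(n1 + n2) => F (rsubmx v)) u.
Proof.
move=> dF; apply: (@differentiable_comp _ _ _ _ rsubmx F) => //.
exact: differentiable_rsubmx.
Qed.

Definition box (U1 : set 'rV[R]_n1) (U2 : set 'rV[R]_n2) : set 'rV[R]_(n1 + n2) :=
  [set u | U1 (lsubmx u) /\ U2 (rsubmx u)].

Lemma open_box U1 U2 : open U1 -> open U2 -> open (box U1 U2).
Proof.
move=> o1 o2; apply: openI.
  by apply: (open_comp (f := lsubmx)) o1 => v _; exact: continuous_lsubmx.
by apply: (open_comp (f := rsubmx)) o2 => v _; exact: continuous_rsubmx.
Qed.

Lemma trace_mx_block (A : 'M[R]_n1) (B : 'M[R]_n2) (S : 'M[R]_(n1 + n2)) :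
  A \in unitmx -> B \in unitmx ->
  trace_mx (block_mx A 0 0 B) S = trace_mx A (ulsubmx S) + trace_mx B (drsubmx S).
Proof.
move=> uA uB; rewrite /trace_mx invmx_block_diag; last first.
  by rewrite unitmxE det_ublock unitrM -!unitmxE uA.
by rewrite -{1}(submxK S) mulmx_block mxtrace_block !mul0mx addr0 add0r.
Qed.

End SubmxPartial.

Section WarpedProduct.
Variables (R : realType) (n1 n2 : nat) (U1 : set 'rV[R]_n1) (U2 : set 'rV[R]_n2).
Variables (G1 : 'rV[R]_n1 -> 'M[R]_n1) (w : 'rV[R]_n1 -> R) (H : 'rV[R]_n2 -> 'M[R]_n2).
Hypothesis oU1 : open U1.
Hypothesis oU2 : open U2.
Hypothesis uG1 : forall u, U1 u -> G1 u \in unitmx.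
Hypothesis uH : forall u, U2 u -> H u \in unitmx.
Hypothesis HT : forall u, U2 u -> (H u)^T = H u.
Hypothesis sw : smooth_on U1 w.
Hypothesis sH : forall a b, smooth_on U2 (fun u => H u a b).

(** Writing the warping function as [e^w] builds in its positivity and turns its logarithmic
    derivatives into derivatives of [w]. *)
Definition warped_mx (u : 'rV[R]_(n1 + n2)) : 'M[R]_(n1 + n2) :=
  block_mx (G1 (lsubmx u)) 0 0 (expR (2 * w (lsubmx u)) *: H (rsubmx u)).

Local Notation G := warped_mx.
Local Notation W := (box U1 U2).

Let oW : open W. Proof. exact: open_box. Qed.

Let Gll j k : (fun v => G v (lshift n2 j) (lshift n2 k)) = (fun v => G1 (lsubmx v) j k).
Proof. by apply/funext => v; rewrite /G block_mxEul. Qed.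

Let Glr j b : (fun v => G v (lshift n2 j) (rshift n1 b)) = (fun=> 0).
Proof. by apply/funext => v; rewrite /G block_mxEur mxE. Qed.

Let Grl a k : (fun v => G v (rshift n1 a) (lshift n2 k)) = (fun=> 0).
Proof. by apply/funext => v; rewrite /G block_mxEdl mxE. Qed.

Let Grr a b : (fun v => G v (rshift n1 a) (rshift n1 b))
  = (fun v => expR (2 * w (lsubmx v)) * H (rsubmx v) a b).
Proof. by apply/funext => v; rewrite /G block_mxEdr mxE. Qed.

Let dw2 u : W u -> differentiable (fun v : 'rV[R]_(n1 + n2) => 2 * w (lsubmx v)) u.
Proof.
move=> [U1u _]; apply: differentiableZ; apply: differentiable_comp_lsubmx.
exact: (sw [::]).
Qed.

Let dHr u a b : W u -> differentiable (fun v : 'rV[R]_(n1 + n2) => H (rsubmx v) a b) u.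
Proof.
move=> [_ U2u]; apply: (differentiable_comp_rsubmx (F := fun v => H v a b)).
exact: (sH a b [::]).
Qed.

Let partial_Grr_l u i a b : W u ->
  partial (lshift n2 i) (fun v => G v (rshift n1 a) (rshift n1 b)) u
  = 2 * partial i w (lsubmx u) * (expR (2 * w (lsubmx u)) *: H (rsubmx u)) a b.
Proof.
move=> Wu; have d2 := dw2 Wu; have dh := dHr a b Wu; rewrite Grr.
have dwl : differentiable (fun v : 'rV[R]_(n1 + n2) => w (lsubmx v)) u.
  by apply: differentiable_comp_lsubmx; case: Wu => U1u _; exact: (sw [::]).
rewrite partialM //; last exact: differentiable_expR_comp.
rewrite (partial_rsubmx_lshift (fun v => H v a b)) partial_expR // partialZ //.
rewrite partial_lsubmx_lshift [in RHS]mxE.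
by move: (partial i w _) (expR _) => p e; ring.
Qed.

Let partial_Grr_r u c a b : W u ->
  partial (rshift n1 c) (fun v => G v (rshift n1 a) (rshift n1 b)) u
  = expR (2 * w (lsubmx u)) * partial c (fun v => H v a b) (rsubmx u).
Proof.
move=> Wu; have d2 := dw2 Wu; have dh := dHr a b Wu; rewrite Grr.
rewrite partialM //; last exact: differentiable_expR_comp.
rewrite (partial_rsubmx_rshift (fun v => H v a b)).
by rewrite (partial_lsubmx_rshift (fun v => expR (2 * w v))) mul0r add0r.
Qed.

Lemma warped_mx_unit u : W u -> expR (2 * w (lsubmx u)) *: H (rsubmx u) \in unitmx.
Proof. by move=> [_ U2u]; rewrite unitmxZ ?uH // unitfE expR_eq0. Qed.

Let invG u : W u -> invmx (G u) = block_mx (invmx (G1 (lsubmx u))) 0 0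
  (invmx (expR (2 * w (lsubmx u)) *: H (rsubmx u))).
Proof.
move=> Wu; rewrite /G invmx_block_diag // unitmxE det_ublock unitrM -!unitmxE.
by rewrite warped_mx_unit // andbT; case: Wu => U1u _; exact: uG1.
Qed.

Let christoffel_l u l i j : W u -> christoffel G (lshift n2 l) i j u
  = 2^-1 * \sum_m invmx (G1 (lsubmx u)) l m *
    (partial i (fun v => G v j (lshift n2 m)) u + partial j (fun v => G v i (lshift n2 m)) u
     - partial (lshift n2 m) (fun v => G v i j) u).
Proof.
move=> Wu; rewrite /christoffel invG // big_split_ord /=.
rewrite [X in _ + X]big1 ?addr0; last by move=> a _; rewrite block_mxEur mxE mul0r.
by congr (_ * _); apply: eq_bigr => m _; rewrite block_mxEul.
Qed.

Let christoffel_r u a i j : W u -> christoffel G (rshift n1 a) i j u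
  = 2^-1 * \sum_d invmx (expR (2 * w (lsubmx u)) *: H (rsubmx u)) a d *
    (partial i (fun v => G v j (rshift n1 d)) u + partial j (fun v => G v i (rshift n1 d)) u
     - partial (rshift n1 d) (fun v => G v i j) u).
Proof.
move=> Wu; rewrite /christoffel invG // big_split_ord /=.
rewrite [X in X + _]big1 ?add0r; last by move=> m _; rewrite block_mxEdl mxE mul0r.
by congr (_ * _); apply: eq_bigr => m _; rewrite block_mxEdr.
Qed.

Lemma christoffel_warped_hhh u l i j : W u ->
  christoffel G (lshift n2 l) (lshift n2 i) (lshift n2 j) u = christoffel G1 l i j (lsubmx u).
Proof.
move=> Wu; rewrite christoffel_l //; congr (_ * _); apply: eq_bigr => m _.
rewrite !Gll (partial_lsubmx_lshift (fun v => G1 v j m)).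
by rewrite (partial_lsubmx_lshift (fun v => G1 v i m)) (partial_lsubmx_lshift (fun v => G1 v i j)).
Qed.

Lemma christoffel_warped_hhv u l i b : W u ->
  christoffel G (lshift n2 l) (lshift n2 i) (rshift n1 b) u = 0.
Proof.
move=> Wu; rewrite christoffel_l // big1 ?mulr0 // => m _.
rewrite Grl Glr Gll !partial_cst (partial_lsubmx_rshift (fun v => G1 v i m)).
by rewrite addr0 subr0 mulr0.
Qed.

Lemma christoffel_warped_hvh u l a j : W u ->
  christoffel G (lshift n2 l) (rshift n1 a) (lshift n2 j) u = 0.
Proof.
move=> Wu; rewrite christoffel_l // big1 ?mulr0 // => m _.
rewrite !Grl Gll !partial_cst (partial_lsubmx_rshift (fun v => G1 v j m)).
by rewrite addr0 subr0 mulr0.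
Qed.

Lemma christoffel_warped_vhh u a i j : W u ->
  christoffel G (rshift n1 a) (lshift n2 i) (lshift n2 j) u = 0.
Proof.
move=> Wu; rewrite christoffel_r // big1 ?mulr0 // => d _.
rewrite !Glr Gll !partial_cst (partial_lsubmx_rshift (fun v => G1 v i j)).
by rewrite addr0 subr0 mulr0.
Qed.

(** A horizontal derivative of the vertical block is [2 dw] times that block; contracting with the
    inverse block leaves a Kronecker delta. Both mixed Christoffel symbols with a vertical upper
    index reduce to this. *)
Let warped_trace u a b (c : R) : W u ->
  2^-1 * (\sum_d invmx (expR (2 * w (lsubmx u)) *: H (rsubmx u)) a d *
    (2 * c * (expR (2 * w (lsubmx u)) *: H (rsubmx u)) b d)) = (a == b)%:R * c.
Proof.
move=> Wu; set E := _ *: _; have uE : E \in unitmx by exact: warped_mx_unit.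
have ET : E^T = E by rewrite /E linearZ /= HT //; case: Wu.
rewrite (eq_bigr (fun d => 2 * c * (invmx E a d * E d b))); last first.
  by move=> d _; rewrite mulrCA -[in LHS]ET [E^T _ _]mxE ET.
have := mulVmx uE => /matrixP /(_ a b); rewrite mxE [RHS]mxE => e.
by rewrite -mulr_sumr e; field.
Qed.

Lemma christoffel_warped_vvh u a b k : W u ->
  christoffel G (rshift n1 a) (rshift n1 b) (lshift n2 k) u
  = (a == b)%:R * partial k w (lsubmx u).
Proof.
move=> Wu; rewrite christoffel_r // -(warped_trace _ _ _ Wu); congr (_ * _).
apply: eq_bigr => d _; rewrite Glr Grl !partial_cst partial_Grr_l //.
by rewrite add0r subr0.
Qed.

Lemma christoffel_warped_vhv u a b k : W u ->
  christoffel G (rshift n1 a) (lshift n2 k) (rshift n1 b) u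
  = (a == b)%:R * partial k w (lsubmx u).
Proof.
move=> Wu; rewrite christoffel_r // -(warped_trace _ _ _ Wu); congr (_ * _).
apply: eq_bigr => d _; rewrite !Glr !partial_cst partial_Grr_l //.
by rewrite addr0 subr0.
Qed.

(** There is no sum over [a]: every vertical direction contributes the same amount to the horizontal
    Ricci block. The second derivative and the horizontal Christoffel terms form the Hessian of [w];
    the vertical terms give the product of first derivatives. *)
Let riemann_vertical u j k a : W u ->
  riemann G (rshift n1 a) (lshift n2 k) (rshift n1 a) (lshift n2 j) u
  = - (hess_mx G1 w (lsubmx u) j k + partial j w (lsubmx u) * partial k w (lsubmx u)).
Proof.
move=> Wu; have uW : u \in W by rewrite inE.
rewrite /riemann big_split_ord /=.
rewrite (partial_eq_on (k := fun=> 0) _ oW) //; last first.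
  by move=> v; rewrite inE => Wv; exact: christoffel_warped_vhh.
rewrite partial_cst (partial_eq_on (k := fun v => partial k w (lsubmx v)) _ oW) //; last first.
  by move=> v; rewrite inE => Wv; rewrite christoffel_warped_vvh // eqxx mul1r.
rewrite partial_lsubmx_lshift [hess_mx _ _ _ _ _]mxE.
have -> : \sum_(b < n2) (christoffel G (rshift n1 a) (rshift n1 a) (rshift n1 b) u
      * christoffel G (rshift n1 b) (lshift n2 j) (lshift n2 k) u
    - christoffel G (rshift n1 a) (lshift n2 j) (rshift n1 b) u
      * christoffel G (rshift n1 b) (rshift n1 a) (lshift n2 k) u)
  = - (partial j w (lsubmx u) * partial k w (lsubmx u)).
  rewrite (bigD1 a) //= [X in _ + X]big1 ?addr0; last first.
    move=> b ba; rewrite christoffel_warped_vhh // christoffel_warped_vhv //.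
    by rewrite eq_sym (negbTE ba) mulr0 !mul0r subr0.
  rewrite christoffel_warped_vhh // christoffel_warped_vhv // christoffel_warped_vvh //.
  by rewrite eqxx !mul1r mulr0 sub0r.
rewrite (eq_bigr (fun m => christoffel G1 m j k (lsubmx u) * partial m w (lsubmx u))); last first.
  move=> m _; rewrite christoffel_warped_vvh // christoffel_warped_hhh //.
  by rewrite christoffel_warped_hvh // eqxx mul1r mulr0 subr0 mulrC.
by rewrite sub0r !opprD opprK addrA.
Qed.

(** In the trace defining Ricci, the horizontal indices reproduce the Ricci tensor of [G1], and the
    [n2] vertical indices contribute equally. *)
Lemma ricci_mx_warped u : W u ->
  ulsubmx (ricci_mx G u) = ricci_mx G1 (lsubmx u)
    - n2%:R *: (hess_mx G1 w (lsubmx u) + (diff_row w (lsubmx u))^T *m diff_row w (lsubmx u)).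
Proof.
move=> Wu; have uW : u \in W by rewrite inE.
apply/matrixP => j k; rewrite [LHS]mxE [LHS]mxE [LHS]mxE big_split_ord /=.
rewrite (eq_bigr (fun i => riemann G1 i k i j (lsubmx u))); last first.
  move=> i _; rewrite /riemann big_split_ord /= [X in _ + (_ + X)]big1 ?addr0; last first.
    move=> b _; rewrite christoffel_warped_hhv // christoffel_warped_vhh //.
    by rewrite christoffel_warped_hhv // !mul0r subr0.
  rewrite (partial_eq_on (h := christoffel G (lshift n2 i) (lshift n2 j) (lshift n2 k))
    (k := fun v => christoffel G1 i j k (lsubmx v)) (lshift n2 i) oW) //; last first.
    by move=> v; rewrite inE => Wv; exact: christoffel_warped_hhh.
  rewrite (partial_eq_on (h := christoffel G (lshift n2 i) (lshift n2 i) (lshift n2 k))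
    (k := fun v => christoffel G1 i i k (lsubmx v)) (lshift n2 j) oW) //; last first.
    by move=> v; rewrite inE => Wv; exact: christoffel_warped_hhh.
  rewrite !partial_lsubmx_lshift; congr (_ + _); apply: eq_bigr => m _.
  by rewrite !christoffel_warped_hhh.
under [X in _ + X]eq_bigr do rewrite riemann_vertical //.
rewrite sumrN sumr_const card_ord -[X in _ - X]mulr_natl [RHS]mxE [ricci_mx G1 _ _ _]mxE.
congr (_ + _); rewrite [RHS]mxE; congr (- _); rewrite [RHS]mxE; congr (_ * _).
by rewrite [RHS]mxE; congr (_ + _); rewrite mxE big_ord1 !mxE.
Qed.

(** * Lie derivative of a warped metric along a projectable field *)

Variables (Z : 'rV[R]_(n1 + n2) -> 'rV[R]_(n1 + n2)).
Variables (Z1 : 'rV[R]_n1 -> 'rV[R]_n1) (Z2 : 'rV[R]_n2 -> 'rV[R]_n2).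
Hypothesis ZE : forall u, W u -> Z u = row_mx (Z1 (lsubmx u)) (Z2 (rsubmx u)).

Let partial_Zl u i k : W u ->
  partial i (fun v => Z v 0 (lshift n2 k)) u
  = partial i (fun v => Z1 (lsubmx v) 0 k) u.
Proof.
move=> Wu; apply: (partial_eq_on i oW); last by rewrite inE.
by move=> v; rewrite inE => Wv; rewrite ZE // row_mxEl.
Qed.

Let partial_Zr u i k : W u ->
  partial i (fun v => Z v 0 (rshift n1 k)) u
  = partial i (fun v => Z2 (rsubmx v) 0 k) u.
Proof.
move=> Wu; apply: (partial_eq_on i oW); last by rewrite inE.
by move=> v; rewrite inE => Wv; rewrite ZE // row_mxEr.
Qed.

Lemma lie_mx_warped_ul u : W u ->
  ulsubmx (lie_mx Z G u) = lie_mx Z1 G1 (lsubmx u).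
Proof.
move=> Wu; apply/matrixP => i j; rewrite [LHS]mxE [LHS]mxE [LHS]mxE [RHS]mxE big_split_ord /=.
rewrite [X in _ + X]big1 ?addr0; last first.
  move=> c _; rewrite Gll (partial_lsubmx_rshift (fun v => G1 v i j)).
  rewrite [G u _ (lshift _ _)](congr1 (@^~ u) (Grl c j)) [G u _ _](congr1 (@^~ u) (Glr i c)).
  by rewrite mulr0 !mul0r !addr0.
apply: eq_bigr => k _; rewrite ![G u _ _]block_mxEul ZE // row_mxEl !partial_Zl // Gll.
by rewrite (partial_lsubmx_lshift (fun v => G1 v i j)) !(partial_lsubmx_lshift (fun v => Z1 v 0 k)).
Qed.

(** The vertical part of [Z] sees the warping factor as a constant, while the horizontal part only
    differentiates it, which yields [2 Z1(w)] times the vertical metric. *)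
Lemma lie_mx_warped_dr u : W u ->
  drsubmx (lie_mx Z G u) = expR (2 * w (lsubmx u)) *: (lie_mx Z2 H (rsubmx u)
    + (2 * (Z1 (lsubmx u) *m (diff_row w (lsubmx u))^T) 0 0) *: H (rsubmx u)).
Proof.
move=> Wu; apply/matrixP => a b; rewrite [LHS]mxE [LHS]mxE [LHS]mxE big_split_ord /= addrC.
rewrite [RHS]mxE [X in _ = _ * X]mxE mulrDr; congr (_ + _).
  rewrite [lie_mx _ _ _ _ _]mxE mulr_sumr; apply: eq_bigr => c _.
  rewrite ![G u _ _]block_mxEdr ZE // row_mxEr !partial_Zr // partial_Grr_r //.
  rewrite !(partial_rsubmx_rshift (fun v => Z2 v 0 c)) ![(_ *: H _) _ _]mxE.
  move: (expR _) (partial a _ _) (partial b _ _) (partial c _ _) => e p q r.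
  by move: (Z2 _ 0 c) (H _ c b) (H _ a c) => x y z; ring.
rewrite [(_ *: H _) _ _]mxE mxE !(mulr_sumr, mulr_suml); apply: eq_bigr => k _.
rewrite partial_Grr_l // [G u _ (rshift _ _)](congr1 (@^~ u) (Glr k b)).
rewrite [G u _ _](congr1 (@^~ u) (Grl a k)) ZE // row_mxEl !mul0r !addr0.
rewrite [(_ *: H _) _ _]mxE [_^T _ _]mxE [diff_row _ _ _ _]mxE.
move: (expR _) (partial k _ _) (Z1 _ 0 k) (H _ a b) => e p x y; ring.
Qed.

End WarpedProduct.

(** * Chart-independent objects *)

Section Charts.
Variables (R : realType) (n : nat) (M : atlas R n).
Hypothesis hM : smooth_manifold M.
Implicit Types (i j : mindex M) (p : M) (u : 'rV[R]_n).

Lemma mcod_open i : open (mcod i).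
Proof. exact: manifold_cod_open. Qed.

Lemma mcod_coord i p : mdom i p -> mcod i (mcoord i p).
Proof. by move=> ip; exists p. Qed.

Lemma mdom_param i u : mcod i u -> mdom i (mparam i u).
Proof. by case=> p ip <-; rewrite (manifold_coordK hM). Qed.

Lemma mparamK i u : mcod i u -> mcoord i (mparam i u) = u.
Proof. by case=> p ip <-; rewrite (manifold_coordK hM). Qed.

Lemma overlapE i j : overlap i j = [set u | mcod i u /\ mdom j (mparam i u)].
Proof.
apply/seteqP; split=> u /=.
  by case=> p [ip jp] <-; split; [exists p|rewrite (manifold_coordK hM)].
move=> [iu ju]; exists (mparam i u); last exact: mparamK.
by split=> //; exact: mdom_param.
Qed.

(** In chart [i] the overlap is the preimage of the open domain of [j] under the parametrization,
    which is continuous on the open set [mcod i]. *)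
Lemma open_overlap i j : open (overlap i j).
Proof.
rewrite overlapE openE => u [iu ju]; rewrite /interior.
have ci : open (mcod i) by exact: mcod_open.
have cp : {for u, continuous (mparam i)}.
  have := @manifold_param_continuous _ _ _ hM i.
  by rewrite continuous_open_subspace // => /(_ u); apply; rewrite inE.
apply: filterI; first by apply: open_nbhs_nbhs.
by apply: cp; apply: open_nbhs_nbhs; split=> //; exact: manifold_dom_open.
Qed.

Lemma overlap_cod i j u : overlap i j u -> mcod i u.
Proof. by rewrite overlapE => -[]. Qed.

Lemma transition_cod i j u : overlap i j u -> mcod j (transition i j u).
Proof. by rewrite overlapE => -[_ ju]; exists (mparam i u). Qed.

Lemma mparam_transition i j u : overlap i j u -> mparam j (transition i j u) = mparam i u.
Proof. by rewrite overlapE => -[_ ju]; rewrite /transition /= (manifold_coordK hM). Qed.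

Lemma overlap_mchart i u : mcod i u -> overlap i (mchart (mparam i u)) u.
Proof. by rewrite overlapE => iu; split=> //; exact: manifold_chart. Qed.

Lemma smooth_fun_eq (h k : M -> R) : h =1 k -> smooth_fun h -> smooth_fun k.
Proof. by move=> /funext ->. Qed.

(** Serves for scalars defined through [mchart p], a choice of chart that need not vary continuously
    with [p]: it suffices to give one smooth formula valid throughout each chart. *)
Lemma smooth_fun_chart (h : M -> R) :
  (forall i, exists2 F, smooth_on (mcod i) F & forall u, mcod i u -> h (mparam i u) = F u) ->
  smooth_fun h.
Proof.
move=> hF i; have [F sF hE] := hF i.
refine (smooth_on_eq (@mcod_open i) _ sF) => u; rewrite inE => iu.
by rewrite /= hE.
Qed.

Section Metric.
Variable g : tensor2 M.
Hypothesis hg : pseudo_riemannian g.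

Lemma metric_smooth i a b : smooth_on (mcod i) (fun u => g i u a b).
Proof. by case: hg => -[sg _] _; exact: sg. Qed.

Lemma metric_symmetric i u : mcod i u -> (g i u)^T = g i u.
Proof. by case: hg => _ h /h []. Qed.

Lemma metric_unit i u : mcod i u -> g i u \in unitmx.
Proof. by case: hg => _ h /h []. Qed.

Lemma metric_transition i j u : overlap i j u ->
  g i u = 'J (transition i j) u *m g j (transition i j u) *m ('J (transition i j) u)^T.
Proof. by case: hg => -[_ h] _ /h. Qed.

Lemma metric_unit_in i : {in mcod i, forall u, g i u \in unitmx}.
Proof. by move=> u; rewrite inE; exact: metric_unit. Qed.

Section Scalar.
Variables (i j : mindex M) (u : 'rV[R]_n) (h : M -> R).
Hypothesis sh : smooth_fun h.
Hypothesis ou : overlap i j u.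

Let hT v : overlap i j v -> (h \o mparam i) v = (h \o mparam j) (transition i j v).
Proof. by move=> ov; rewrite /= mparam_transition. Qed.

Lemma diff_row_transition : diff_row (h \o mparam i) u
  = diff_row (h \o mparam j) (transition i j u) *m ('J (transition i j) u)^T.
Proof.
apply: (diff_row_chart_change (@open_overlap i j) (@transition_cod i j)
  (@manifold_transition _ _ _ hM i j) hT (@sh j) ou).
Qed.

Lemma gradient_transition :
  gradient g h i u *m 'J (transition i j) u = gradient g h j (transition i j u).
Proof.
apply: (grad_row_chart_change (@open_overlap i j) (@transition_cod i j)
  (@manifold_transition _ _ _ hM i j) hT (@sh j) ou (@metric_transition i j)).
  exact/metric_unit/overlap_cod/ou.
exact/metric_unit/transition_cod.
Qed.

Lemma hessian_transition : hessian g h i u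
  = 'J (transition i j) u *m hessian g h j (transition i j u) *m ('J (transition i j) u)^T.
Proof.
apply: (hess_mx_chart_change (@open_overlap i j) (@transition_cod i j)
  (@manifold_transition _ _ _ hM i j) hT (@sh j) ou (@metric_transition i j)).
- exact/metric_unit/overlap_cod/ou.
- exact/metric_unit/transition_cod.
- exact: metric_smooth.
- exact/metric_symmetric/transition_cod.
Qed.

Lemma tensor_square_transition : tensor_square h i u
  = 'J (transition i j) u *m tensor_square h j (transition i j u)
    *m ('J (transition i j) u)^T.
Proof. by rewrite /tensor_square diff_row_transition trmx_mul trmxK !mulmxA. Qed.

End Scalar.

Variables (k s : M -> R).
Hypothesis sk : smooth_fun k.
Hypothesis ss : smooth_fun s.

Lemma obstruction_transition i j u : overlap i j u -> obstruction g k s i u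
  = 'J (transition i j) u *m obstruction g k s j (transition i j u)
    *m ('J (transition i j) u)^T.
Proof.
move=> ou; rewrite /obstruction !(mulmxBr, mulmxBl, mulmxDr, mulmxDl).
by rewrite !(hessian_transition _ ou, tensor_square_transition _ ou).
Qed.

(** Gradients transform by the Jacobian and the metric by its two-sided action, so the value in the
    chart selected by [mchart] agrees with the value in chart [i]. *)
Lemma obstruction_scalarE i u : mcod i u -> obstruction_scalar g k s (mparam i u)
  = inner_mx (g i u) (gradient g k i u) (gradient g s i u)
    + inner_mx (g i u) (gradient g s i u) (gradient g s i u).
Proof.
move=> iu; have ou := overlap_mchart iu.
rewrite /obstruction_scalar /inner -/(transition i (mchart (mparam i u)) u).
rewrite -!(gradient_transition _ ou) // /inner_mx (metric_transition ou).
by rewrite !trmx_mul !mulmxA.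
Qed.

Lemma smooth_obstruction i a b : smooth_on (mcod i) (fun u => obstruction g k s i u a b).
Proof.
have oi := @mcod_open i.
have sgi := @metric_smooth i.
have ugi := @metric_unit_in i.
have sq h : smooth_fun h -> smooth_on (mcod i) (fun u => tensor_square h i u a b).
  move=> sh; apply: smooth_on_mulmx => // x y.
    by rewrite (ord1 y); under eq_fun do rewrite mxE; apply: smooth_on_diff_row; exact: sh.
  by rewrite (ord1 x); apply: smooth_on_diff_row; exact: sh.
have shess h : smooth_fun h -> smooth_on (mcod i) (fun u => hessian g h i u a b).
  by move=> sh; apply: smooth_on_hess_mx => //; exact: sh.
apply: (smooth_on_eq oi (h := fun u => hessian g k i u a b + tensor_square k i u a b
  + hessian g s i u a b - tensor_square s i u a b)).
  move=> u _; rewrite /obstruction.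
  move: (hessian g k i u) (hessian g s i u) (tensor_square k i u) (tensor_square s i u).
  by move=> A B C D; rewrite !mxE.
apply: smooth_onB => //; last exact: sq.
apply: smooth_onD => //; last exact: shess.
by apply: smooth_onD => //; [exact: shess|exact: sq].
Qed.

Lemma smooth_gradient h i a : smooth_fun h ->
  smooth_on (mcod i) (fun u => gradient g h i u 0 a).
Proof.
move=> sh; have oi := @mcod_open i; apply: smooth_on_mulmx => // x y.
  by rewrite (ord1 x); apply: smooth_on_diff_row; exact: sh.
by apply: smooth_on_invmx => //; [exact: metric_unit_in|exact: metric_smooth].
Qed.

Lemma smooth_obstruction_scalar : smooth_fun (obstruction_scalar g k s).
Proof.
apply: smooth_fun_chart => i; eexists; last by move=> u; exact: obstruction_scalarE.
have oi := @mcod_open i.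
have si h l : smooth_fun h -> smooth_fun l -> smooth_on (mcod i)
    (fun u => inner_mx (g i u) (gradient g h i u) (gradient g l i u)).
  move=> sh sl; apply: smooth_on_mulmx => // x y.
    apply: smooth_on_mulmx => // x' y'; last exact: metric_smooth.
    by rewrite (ord1 x'); exact: smooth_gradient.
  by rewrite (ord1 y); under eq_fun do rewrite mxE; exact: smooth_gradient.
by apply: smooth_onD => //; exact: si.
Qed.

End Metric.

Variables (Z : vfield M) (h : M -> R).
Hypothesis hZ : smooth_vfield Z.
Hypothesis sh : smooth_fun h.

(** The derivative [Z(h)] of [h] along [Z], evaluated in the chart selected at [p]. *)
Definition vfield_apply p : R :=
  let i := mchart p in let u := mcoord i p in
  (Z i u *m (diff_row (h \o mparam i) u)^T) 0 0.

Lemma vfield_applyE i u : mcod i u ->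
  vfield_apply (mparam i u) = (Z i u *m (diff_row (h \o mparam i) u)^T) 0 0.
Proof.
move=> iu; have ou := overlap_mchart iu.
rewrite /vfield_apply -/(transition i (mchart (mparam i u)) u).
rewrite (diff_row_transition sh ou) trmx_mul trmxK mulmxA.
by case: hZ => _ ->.
Qed.

Lemma smooth_vfield_apply : smooth_fun vfield_apply.
Proof.
apply: smooth_fun_chart => i; eexists; last by move=> u; exact: vfield_applyE.
have oi := @mcod_open i; apply: smooth_on_mulmx => // x y.
  by rewrite (ord1 x); case: hZ => sZ _; exact: sZ.
by rewrite (ord1 y); under eq_fun do rewrite mxE; apply: smooth_on_diff_row; exact: sh.
Qed.

End Charts.

(** * The soliton equation *)

Lemma ulsubmxDZ (R : realType) n1 n2 (A B : 'M[R]_(n1 + n2)) (a : R) :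
  ulsubmx (A + a *: B) = ulsubmx A + a *: ulsubmx B.
Proof. by apply/matrixP => i j; rewrite !mxE. Qed.

Lemma drsubmxDZ (R : realType) n1 n2 (A B : 'M[R]_(n1 + n2)) (a : R) :
  drsubmx (A + a *: B) = drsubmx A + a *: drsubmx B.
Proof. by apply/matrixP => i j; rewrite !mxE. Qed.

(** * Smooth functions and conformal metrics on a manifold *)

Section SmoothFun.
Variables (R : realType) (n : nat) (M : atlas R n).
Hypothesis hM : smooth_manifold M.
Implicit Types h k : M -> R.

Lemma smooth_fun_cst (a : R) : smooth_fun (fun _ : M => a).
Proof. by move=> i; apply: smooth_on_cst; exact: mcod_open. Qed.

Lemma smooth_funD h k : smooth_fun h -> smooth_fun k -> smooth_fun (fun p => h p + k p).
Proof. by move=> sh sk i; apply: smooth_onD; [exact: mcod_open|exact: sh|exact: sk]. Qed.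

Lemma smooth_funB h k : smooth_fun h -> smooth_fun k -> smooth_fun (fun p => h p - k p).
Proof. by move=> sh sk i; apply: smooth_onB; [exact: mcod_open|exact: sh|exact: sk]. Qed.

Lemma smooth_funM h k : smooth_fun h -> smooth_fun k -> smooth_fun (fun p => h p * k p).
Proof. by move=> sh sk i; apply: smooth_onM; [exact: mcod_open|exact: sh|exact: sk]. Qed.

Lemma smooth_funZ (a : R) h : smooth_fun h -> smooth_fun (fun p => a * h p).
Proof. exact: smooth_funM (smooth_fun_cst a). Qed.

Lemma smooth_fun_expR h : smooth_fun h -> smooth_fun (fun p => expR (h p)).
Proof. by move=> sh i; apply: smooth_on_expR; [exact: mcod_open|exact: sh]. Qed.

Lemma pseudo_riemannian_conformal (g : tensor2 M) h :
  pseudo_riemannian g -> smooth_fun h ->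
  pseudo_riemannian (scale_tensor2 (fun p => expR (2 * h p)) g).
Proof.
move=> [[sg tg] ug] sh; split; first split.
- move=> i k l; rewrite /scale_tensor2; under eq_fun do rewrite mxE.
  apply: smooth_onM; [exact: mcod_open|exact: (smooth_fun_expR (smooth_funZ 2 sh))|exact: sg].
- move=> i j u ou; rewrite /scale_tensor2 (tg _ _ _ ou) (mparam_transition hM ou).
  by rewrite -scalemxAr -scalemxAl.
move=> i u iu; have [gT gu] := ug i u iu; rewrite /scale_tensor2; split.
  by rewrite linearZ /= gT.
by rewrite unitmxZ // unitfE expR_eq0.
Qed.

End SmoothFun.

(** * Traces and pure-trace matrices *)

Section PureTrace.
Variables (R : realType) (n : nat).
Hypothesis n0 : (0 < n)%N.
Implicit Types G S : 'M[R]_n.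

Let nR0 : n%:R != 0 :> R.
Proof. by rewrite pnatr_eq0 -lt0n. Qed.

Lemma trace_mxZ G (a : R) : G \in unitmx -> trace_mx G (a *: G) = a * n%:R.
Proof. by move=> uG; rewrite /trace_mx -scalemxAr mulVmx // mxtraceZ mxtrace1. Qed.

Lemma trace_mx_scaleG G S (c : R) : c != 0 -> G \in unitmx ->
  trace_mx (c *: G) S = c^-1 * trace_mx G S.
Proof.
move=> c0 uG; rewrite /trace_mx invmxZ; last by rewrite unitmxZ // unitfE.
by rewrite -scalemxAl mxtraceZ.
Qed.

Lemma trace_mxD G S S' : trace_mx G (S + S') = trace_mx G S + trace_mx G S'.
Proof. by rewrite /trace_mx mulmxDr mxtraceD. Qed.

Lemma trace_mxZr G S (a : R) : trace_mx G (a *: S) = a * trace_mx G S.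
Proof. by rewrite /trace_mx -scalemxAr mxtraceZ. Qed.

(** The trace of [a *: G] with respect to [G] is [a n], and positive dimension allows division by
    [n]. *)
Lemma scale_unitmx_inj G (a b : R) : G \in unitmx -> a *: G = b *: G -> a = b.
Proof.
move=> uG /(congr1 (trace_mx G)); rewrite !trace_mxZ // => /mulIf; exact.
Qed.

Lemma tracefree_mxZ G (a : R) : G \in unitmx -> tracefree_mx G (a *: G) = 0.
Proof.
by move=> uG; rewrite /tracefree_mx trace_mxZ // mulrC mulfK // subrr.
Qed.

End PureTrace.

(** * Charts and slices of the product *)

Section Product.
Variables (R : realType) (n1 n2 : nat) (M1 : atlas R n1) (M2 : atlas R n2).
Hypothesis hM1 : smooth_manifold M1.
Hypothesis hM2 : smooth_manifold M2.
Local Notation M := (prod_atlas M1 M2).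

Lemma mcod_prod (i1 : mindex M1) (i2 : mindex M2) u :
  box (mcod i1) (mcod i2) u -> mcod ((i1, i2) : mindex M) u.
Proof.
move=> [[p ip pu] [q jq qu]]; exists (p, q) => //=.
by rewrite pu qu hsubmxK.
Qed.

Lemma box_row_mx (i1 : mindex M1) (i2 : mindex M2) u v :
  mcod i1 u -> mcod i2 v -> box (mcod i1) (mcod i2) (row_mx u v).
Proof. by move=> iu jv; split; rewrite ?row_mxKl ?row_mxKr. Qed.

Lemma smooth_fun_slice (h : M -> R) (y : M2) :
  smooth_fun h -> smooth_fun (fun x => h (x, y)).
Proof.
move=> sh i; have yd := manifold_chart hM2 y; have yc := mcod_coord yd.
have sl := smooth_on_slice (c := mcoord (mchart y) y) _ (@sh (i, mchart y)).
apply: (smooth_on_eq (@mcod_open _ _ _ hM1 i) _ (sl (mcod i) _)).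
  by move=> u _ /=; rewrite row_mxKl row_mxKr (manifold_coordK hM2).
by move=> u iu; apply: mcod_prod; exact: box_row_mx.
Qed.

End Product.

(** * Restriction of the soliton equation to the first factor *)

Section Soliton.
Variables (R : realType) (n1 n2 : nat).
Hypothesis hn1 : (0 < n1)%N.
Hypothesis hn2 : (0 < n2)%N.
Variables (M1 : atlas R n1) (M2 : atlas R n2).
Hypothesis hM1 : smooth_manifold M1.
Hypothesis hM2 : smooth_manifold M2.
Variables (g1 : tensor2 M1) (g2 : tensor2 M2).
Hypothesis hg1 : pseudo_riemannian g1.
Hypothesis hg2 : pseudo_riemannian g2.
Variables (f phi : prod_atlas M1 M2 -> R).
Hypothesis hf0 : forall p, 0 < f p.
Hypothesis hphi0 : forall p, 0 < phi p.
Variables (Z : vfield (prod_atlas M1 M2)) (Z1 : vfield M1) (Z2 : vfield M2).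
Hypothesis hZ1 : smooth_vfield Z1.
Hypothesis hZ : projectable_sum Z Z1 Z2.
Variables (lambda : prod_atlas M1 M2 -> R) (rho : R).
Variables (sigma1 k1 : M1 -> R) (k2 : M2 -> R).
Hypothesis hsigma1 : smooth_fun sigma1.
Hypothesis hk1 : smooth_fun k1.
Hypothesis hk2 : smooth_fun k2.
Hypothesis hsigma : forall (x : M1) (y : M2), ln (phi (x, y)) = sigma1 x.
Hypothesis hk : forall (x : M1) (y : M2), ln (f (x, y)) = k1 x + k2 y.

Let gL := scale_tensor2 (fun p => phi p ^+ 2) (twisted_metric g1 g2 f).
Let gL1 := scale_tensor2 (fun x => expR (2 * sigma1 x)) g1.
Let B1 := obstruction g1 k1 sigma1.
Let b1 := obstruction_scalar g1 k1 sigma1.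
Let RL := scalar_curvature gL.
Let RL1 := scalar_curvature gL1.
Hypothesis hsol : almost_RB_soliton gL Z lambda rho.

Let H2 i2 v := expR (2 * k2 (mparam i2 v)) *: g2 i2 v.
Let w i1 v := (k1 \o mparam i1) v + (sigma1 \o mparam i1) v.

(** Positivity recovers [phi] and [f] from their logarithms. In
    [phi^2 f^2 = e^{2 (k1 + sigma1)} e^{2 k2}] the second factor is absorbed by the fiber metric
    [H2], so the exponent [w] lives on the base. *)
Let gL_warped i1 i2 : gL (i1, i2) = warped_mx (gL1 i1) (w i1) (H2 i2).
Proof.
apply/funext => u; rewrite /gL /scale_tensor2 /twisted_metric /warped_mx /gL1 /H2 /w /=.
set x := mparam i1 _; set y := mparam i2 _.
have -> : phi (x, y) = expR (sigma1 x) by rewrite -(hsigma x y) lnK // posrE.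
have -> : f (x, y) = expR (k1 x + k2 y) by rewrite -hk lnK // posrE.
rewrite scale_block_mx !scaler0 !scalerA -!expRM_natl -!expRD.
by congr (block_mx _ 0 0 (expR _ *: _)); ring.
Qed.

Let hgL1 : pseudo_riemannian gL1.
Proof. exact: pseudo_riemannian_conformal. Qed.

Let hH2 : pseudo_riemannian (H2 : tensor2 M2).
Proof. exact: (pseudo_riemannian_conformal hM2 hg2 hk2). Qed.

Let sw i1 : smooth_on (mcod i1) (w i1).
Proof. by apply: smooth_onD; [exact: mcod_open|exact: hk1|exact: hsigma1]. Qed.

Let ZE i1 i2 u : box (mcod i1) (mcod i2) u ->
  Z (i1, i2) u = row_mx (Z1 i1 (lsubmx u)) (Z2 i2 (rsubmx u)).
Proof.
by move=> /mcod_prod /hZ ->; rewrite /lift1 /lift2 add_row_mx addr0 add0r.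
Qed.

Let ricci_ul i1 i2 u : box (mcod i1) (mcod i2) u ->
  ulsubmx (ricci gL (i1, i2) u) = ricci gL1 i1 (lsubmx u)
    - n2%:R *: (B1 i1 (lsubmx u) + b1 (mparam i1 (lsubmx u)) *: g1 i1 (lsubmx u)).
Proof.
move=> bu; rewrite /ricci gL_warped (ricci_mx_warped (@mcod_open _ _ _ hM1 i1)
  (@mcod_open _ _ _ hM2 i2) (@metric_unit _ _ _ _ hgL1 i1) (@metric_unit _ _ _ _ hH2 i2)
  (@metric_symmetric _ _ _ _ hH2 i2) (@sw i1) (@metric_smooth _ _ _ _ hH2 i2) bu).
case: bu => iu _; rewrite [X in _ - _ *: X](hess_mx_warping (@mcod_open _ _ _ hM1 i1) iu
  (@hk1 i1) (@hsigma1 i1) (@metric_smooth _ _ _ _ hg1 i1) (metric_symmetric hg1 iu)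
  (metric_unit hg1 iu)).
by rewrite /b1 (obstruction_scalarE hM1 hg1 hk1 hsigma1 iu).
Qed.

Let mu x y := lambda (x, y) + rho * RL (x, y).

Let sol_eq i1 i2 u : box (mcod i1) (mcod i2) u ->
  ricci gL (i1, i2) u + 2^-1 *: lie_mx (Z (i1, i2)) (gL (i1, i2)) u
  = mu (mparam i1 (lsubmx u)) (mparam i2 (rsubmx u)) *: gL (i1, i2) u.
Proof. by move=> /mcod_prod; case: hsol => _ _ _; exact. Qed.

(** The horizontal block of the soliton equation, with the warping contribution to Ricci moved to
    the right. The fiber point enters only through [mu]. *)
Let horizontal i1 u y : mcod i1 u ->
  ricci gL1 i1 u + 2^-1 *: lie_derivative Z1 gL1 i1 u
  = mu (mparam i1 u) y *: gL1 i1 u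
    + n2%:R *: (B1 i1 u + b1 (mparam i1 u) *: g1 i1 u).
Proof.
move=> iu; have yd := manifold_chart hM2 y; have yc := mcod_coord yd.
have bu := box_row_mx iu yc; have := congr1 ulsubmx (sol_eq bu).
rewrite ulsubmxDZ ricci_ul // gL_warped.
rewrite (lie_mx_warped_ul (gL1 i1) (w i1) (H2 (mchart y)) (@mcod_open _ _ _ hM1 i1)
  (@mcod_open _ _ _ hM2 (mchart y)) (@ZE i1 (mchart y)) bu).
rewrite -[X in ulsubmx X]add0r ulsubmxDZ /warped_mx block_mxKul row_mxKl row_mxKr.
have -> : ulsubmx (0 : 'M[R]_(n1 + n2)) = 0 by apply/matrixP => i j; rewrite !mxE.
by rewrite (manifold_coordK hM2 yd) add0r => <-; rewrite addrAC subrK.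
Qed.

Section PureTraceObstruction.
Variable beta : M1 -> R.
Hypothesis hbeta : eq_tensor2 B1 (scale_tensor2 beta g1).

Let e x := expR (- 2 * sigma1 x).

Let eE x : e x = (expR (2 * sigma1 x))^-1.
Proof. by rewrite /e mulNr expRN. Qed.

Let obsE i1 u : mcod i1 u ->
  B1 i1 u + b1 (mparam i1 u) *: g1 i1 u
  = (e (mparam i1 u) * (beta (mparam i1 u) + b1 (mparam i1 u))) *: gL1 i1 u.
Proof.
move=> iu; rewrite hbeta // /scale_tensor2 -scalerDl /gL1 /scale_tensor2 scalerA eE.
by rewrite mulrAC mulVf ?mul1r // expR_eq0.
Qed.

(** The value that [lambda1 + rho RL1] must take for the inherited equation to hold. *)
Let nu x y := mu x y + n2%:R * e x * (beta x + b1 x).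

Let horizontal_nu i1 u y : mcod i1 u ->
  ricci gL1 i1 u + 2^-1 *: lie_derivative Z1 gL1 i1 u = nu (mparam i1 u) y *: gL1 i1 u.
Proof.
by move=> iu; rewrite (horizontal y iu) obsE // scalerA -scalerDl mulrA.
Qed.

(** [n1 nu] is the trace of the left-hand side of the base equation, which is built from smooth data
    on [M1]. *)
Let smooth_nu y : smooth_fun (nu ^~ y).
Proof.
apply: (smooth_fun_chart hM1) => i.
exists (fun u => n1%:R^-1 * trace_mx (gL1 i u)
  (ricci gL1 i u + 2^-1 *: lie_derivative Z1 gL1 i u)); last first.
  move=> u iu; rewrite (horizontal_nu y iu) trace_mxZ ?(metric_unit hgL1) //.
  by rewrite mulrC mulfK // pnatr_eq0 -lt0n.
have oi := @mcod_open _ _ _ hM1 i; apply: smooth_onM; [by []|exact: smooth_on_cst|].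
apply: smooth_on_trace_mx => //; [exact: metric_unit_in|exact: metric_smooth|move=> a b].
apply: (smooth_on_eq oi (h := fun u => ricci_mx (gL1 i) u a b
  + 2^-1 * lie_mx (Z1 i) (gL1 i) u a b)).
  by move=> u _; rewrite [RHS]mxE [X in _ = _ + X]mxE.
apply: smooth_onD => //.
  by apply: smooth_on_ricci_mx => //; [exact: metric_unit_in|exact: metric_smooth].
apply: smooth_onM => //; first exact: smooth_on_cst.
apply: smooth_on_lie_mx => //; first exact: metric_smooth.
by case: hZ1.
Qed.

Let smooth_beta : smooth_fun beta.
Proof.
apply: (smooth_fun_chart hM1) => i.
exists (fun u => n1%:R^-1 * trace_mx (g1 i u) (B1 i u)); last first.
  move=> u iu; rewrite hbeta // trace_mxZ ?(metric_unit hg1) //.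
  by rewrite mulrC mulfK // pnatr_eq0 -lt0n.
have oi := @mcod_open _ _ _ hM1 i; apply: smooth_onM; [by []|exact: smooth_on_cst|].
apply: smooth_on_trace_mx => //; [exact: metric_unit_in|exact: metric_smooth|move=> a b].
exact: smooth_obstruction.
Qed.

Let smooth_correction (c : R) : smooth_fun (fun x => c * e x * (beta x + b1 x)).
Proof.
apply: smooth_funM => //; last first.
  by apply: smooth_funD => //; exact: smooth_obstruction_scalar.
apply: smooth_funZ => //; apply: smooth_fun_expR => //; exact: smooth_funZ.
Qed.

Let Zw := vfield_apply Z1 (fun x => k1 x + sigma1 x).

(** The scalar curvature of [gL] is the sum of the traces of two Ricci blocks. The horizontal one
    gives [RL1 - n1 n2 e (beta + b1)]. The vertical one, solved from the soliton equation, gives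
    [n2 mu - n2 Z1(w)] minus half the trace of the Lie derivative of [H2] along [Z2], which depends
    on [y] alone. *)
Let scalar_split x y : RL1 x = RL (x, y) + n2%:R * n1%:R * e x * (beta x + b1 x)
  - n2%:R * mu x y + n2%:R * Zw x
  + 2^-1 * trace_mx (H2 (mchart y) (mcoord (mchart y) y))
      (lie_mx (Z2 (mchart y)) (H2 (mchart y)) (mcoord (mchart y) y)).
Proof.
have xd := manifold_chart hM1 x; have yd := manifold_chart hM2 y.
have xc := mcod_coord xd; have yc := mcod_coord yd; have bu := box_row_mx xc yc.
have xK := manifold_coordK hM1 xd; have yK := manifold_coordK hM2 yd.
set i1 := mchart x in xd xc bu xK *; set i2 := mchart y in yd yc bu yK *.
set u := mcoord i1 x in xc bu xK *; set v := mcoord i2 y in yc bu yK *.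
have uG : gL1 i1 u \in unitmx by exact: (metric_unit hgL1).
have uH : H2 i2 v \in unitmx by exact: (metric_unit hH2).
pose c := expR (2 * w i1 u); have c0 : c != 0 by rewrite expR_eq0.
have ucH : c *: H2 i2 v \in unitmx by rewrite unitmxZ // unitfE.
have gE : gL (i1, i2) (row_mx u v) = block_mx (gL1 i1 u) 0 0 (c *: H2 i2 v).
  by rewrite gL_warped /warped_mx row_mxKl row_mxKr.
(* The product atlas selects charts componentwise, so [RL (x, y)] is by definition computed in the
   chart [(i1, i2)]. *)
have -> : RL (x, y) = trace_mx (gL (i1, i2) (row_mx u v)) (ricci gL (i1, i2) (row_mx u v)).
  by [].
have ricE : drsubmx (ricci gL (i1, i2) (row_mx u v)) = (mu x y - Zw x) *: (c *: H2 i2 v)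
    + (- 2^-1) *: (c *: lie_mx (Z2 i2) (H2 i2) v).
  have := congr1 drsubmx (sol_eq bu); rewrite drsubmxDZ gE -[X in _ = drsubmx X]add0r drsubmxDZ.
  rewrite gL_warped (lie_mx_warped_dr (gL1 i1) (@mcod_open _ _ _ hM1 i1)
    (@mcod_open _ _ _ hM2 i2) (@sw i1) (@metric_smooth _ _ _ _ hH2 i2) (@ZE i1 i2) bu).
  have -> : drsubmx (0 : 'M[R]_(n1 + n2)) = 0 by apply/matrixP => i j; rewrite !mxE.
  rewrite block_mxKdr row_mxKl row_mxKr xK yK add0r -/c.
  rewrite -[(_ *m _) 0 0]/(Zw x).
  move/(canRL (addrK _)) => ->.
  move: (lie_mx _ _ _) (H2 i2 v) => A B.
  by apply/matrixP => i j; rewrite !mxE; field.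
rewrite gE trace_mx_block // ricE trace_mxD.
rewrite (trace_mxZr _ (c *: H2 i2 v)) (trace_mxZr _ (H2 i2 v)).
rewrite (trace_mxZr _ (c *: lie_mx _ _ _)) (trace_mxZr _ (lie_mx _ _ _)).
have trHH : trace_mx (H2 i2 v) (H2 i2 v) = n2%:R.
  by rewrite -[X in trace_mx _ X]scale1r trace_mxZ // mul1r.
rewrite (trace_mx_scaleG (H2 i2 v) c0 uH) trHH (trace_mx_scaleG _ c0 uH).
have := ricci_ul bu; rewrite row_mxKl xK => ->.
have iu : mcod i1 u by exact: xc.
have := obsE iu; rewrite xK => ->.
rewrite -scaleNr trace_mxD (trace_mxZr _ (_ *: gL1 i1 u)) (trace_mxZ _ uG).
rewrite (_ : trace_mx _ (ricci gL1 _ _) = RL1 x) //.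
move: (trace_mx (H2 i2 v) _) => T.
by field.
Qed.

(** The product vanishes for [rho = 0]. Otherwise [mu] is smooth as [nu] minus the correction term,
    [RL] is [(mu - lambda) / rho], and the splitting of the scalar curvature expresses [RL1] through
    smooth functions on the slice. *)
Let smooth_rho_RL1 (y : M2) : smooth_fun (fun x => rho * RL1 x).
Proof.
have [-> | rho0] := eqVneq rho 0.
  by apply: (smooth_fun_eq (h := fun=> 0)); [move=> x; rewrite mul0r|exact: smooth_fun_cst].
have slam : smooth_fun (fun x => lambda (x, y)).
  by apply: smooth_fun_slice => //; case: hsol.
have smu : smooth_fun (mu ^~ y).
  apply: (smooth_fun_eq (h := fun x => nu x y - n2%:R * e x * (beta x + b1 x))).
    by move=> x; rewrite /nu addrK.
  exact: smooth_funB.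
have sRL : smooth_fun (fun x => RL (x, y)).
  apply: (smooth_fun_eq (h := fun x => rho^-1 * (mu x y - lambda (x, y)))).
    by move=> x; rewrite /mu addrC addKr mulKf.
  by apply: smooth_funZ => //; exact: smooth_funB.
apply: smooth_funZ => //.
apply: (smooth_fun_eq (fun x => esym (scalar_split x y))).
apply: smooth_funD => //; last exact: smooth_fun_cst.
apply: smooth_funD => //.
  apply: smooth_funB => //; last exact: smooth_funZ.
  by apply: smooth_funD.
by apply: smooth_funZ => //; apply: smooth_vfield_apply => //; exact: smooth_funD.
Qed.

(** The displayed function is [nu - rho RL1]. Nondegeneracy of [gL1] and [n1 > 0] let the equation
    determine its scalar factor, which gives one direction; conversely the base equation holds with
    factor [nu], and smoothness of [nu] and of [rho RL1] completes the structure. *)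
Lemma inherited_solitonP (y : M2) (lambda1 : M1 -> R) :
  almost_RB_soliton gL1 Z1 lambda1 rho
  <-> (forall x, lambda1 x = lambda (x, y) + rho * (RL (x, y) - RL1 x)
                   + n2%:R * expR (- 2 * sigma1 x) * (beta x + b1 x)).
Proof.
have rhsE x : lambda (x, y) + rho * (RL (x, y) - RL1 x)
    + n2%:R * expR (- 2 * sigma1 x) * (beta x + b1 x) = nu x y - rho * RL1 x.
  by rewrite /nu /mu -/(e x) mulrBr; ring.
split=> [[_ _ _ E] x|E].
  have xd := manifold_chart hM1 x; have xc := mcod_coord xd.
  have := E _ _ xc; rewrite (horizontal_nu y xc) /scale_tensor2 => /esym.
  move/(scale_unitmx_inj hn1 (metric_unit hgL1 xc)).
  by rewrite (manifold_coordK hM1 xd) rhsE => <-; rewrite addrK.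
split=> //.
  apply: (smooth_fun_eq (h := fun x => nu x y - rho * RL1 x)).
    by move=> x; rewrite E rhsE.
  by apply: smooth_funB => //; exact: smooth_rho_RL1.
move=> i u iu; rewrite (horizontal_nu y iu) /scale_tensor2; congr (_ *: _).
by rewrite E rhsE subrK.
Qed.

End PureTraceObstruction.

Lemma inherited_soliton_tracefree (y : M2) :
  (exists lambda1, almost_RB_soliton gL1 Z1 lambda1 rho)
  <-> eq_tensor2 (tracefree g1 B1) (fun _ _ => 0).
Proof.
split=> [[lambda1 [_ _ _ E]] i u iu|tf0].
  have n20 : n2%:R != 0 :> R by rewrite pnatr_eq0 -lt0n.
  have ug := metric_unit hg1 iu.
  rewrite /tracefree; suff [t ->] : exists t, B1 i u = t *: g1 i u by exact: tracefree_mxZ.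
  have := E _ _ iu; rewrite (horizontal y iu) /scale_tensor2 /gL1 /scale_tensor2.
  move: (b1 _) (mu _ _) (lambda1 _ + _) (expR _) => b m l e.
  (* The equation reads [m e C + n2 (A + b C) = l e C]; since [n2] is nonzero it can be solved for
     [A], which gives the multiple of [C]. *)
  move: (B1 i u) (g1 i u) => A C eqn; exists (n2%:R^-1 * (l * e - m * e) - b).
  rewrite scalerBl -scalerA scalerBl -!scalerA -{}eqn addrAC subrr add0r.
  by rewrite scalerA mulVf // scale1r addrK.
pose beta x := let i := mchart x in let u := mcoord i x in
  n1%:R^-1 * trace_mx (g1 i u) (B1 i u).
have hbeta : eq_tensor2 B1 (scale_tensor2 beta g1).
  (* [beta] is defined through one selected chart per point. Both sides transform as tensors, so the
     claim reduces to that chart, where it is the vanishing of the trace-free part. *)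
  move=> i u iu; have ou := overlap_mchart hM1 iu.
  rewrite /B1 (obstruction_transition hM1 hg1 hk1 hsigma1 ou) -/B1.
  rewrite /scale_tensor2 (metric_transition hg1 ou) scalemxAl scalemxAr.
  congr (_ *m _ *m _); apply/eqP; rewrite -subr_eq0; apply/eqP.
  exact: (tf0 _ _ (transition_cod hM1 ou)).
by eexists; apply/(inherited_solitonP hbeta y) => x; reflexivity.
Qed.

End Soliton.

Theorem theorem4p1 (R : realType) (n1 n2 : nat)
    (hn1 : (0 < n1)%N) (hn2 : (0 < n2)%N)
    (M1 : atlas R n1) (M2 : atlas R n2)
    (hM1 : smooth_manifold M1) (hM2 : smooth_manifold M2)
    (g1 : tensor2 M1) (g2 : tensor2 M2)
    (hg1 : pseudo_riemannian g1) (hg2 : pseudo_riemannian g2)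
    (f phi : prod_atlas M1 M2 -> R)
    (hf : smooth_fun f) (hphi : smooth_fun phi)
    (hf0 : forall p, 0 < f p) (hphi0 : forall p, 0 < phi p)
    (Z : vfield (prod_atlas M1 M2)) (Z1 : vfield M1) (Z2 : vfield M2)
    (hZ1 : smooth_vfield Z1) (hZ2 : smooth_vfield Z2)
    (hZ : projectable_sum Z Z1 Z2)
    (lambda : prod_atlas M1 M2 -> R) (rho : R)
    (sigma1 k1 : M1 -> R) (k2 : M2 -> R)
    (hsigma1 : smooth_fun sigma1) (hk1 : smooth_fun k1) (hk2 : smooth_fun k2)
    (hsigma : forall (x : M1) (y : M2), ln (phi (x, y)) = sigma1 x)
    (hk : forall (x : M1) (y : M2), ln (f (x, y)) = k1 x + k2 y) :
  let gL := scale_tensor2 (fun p => phi p ^+ 2) (twisted_metric g1 g2 f) in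
  let gL1 := scale_tensor2 (fun x => expR (2 * sigma1 x)) g1 in
  let B1 := obstruction g1 k1 sigma1 in
  let b1 := obstruction_scalar g1 k1 sigma1 in
  let RL := scalar_curvature gL in
  let RL1 := scalar_curvature gL1 in
  almost_RB_soliton gL Z lambda rho ->
  (* for each slice: inherited structure iff the trace-free part vanishes *)
  (forall y : M2,
      (exists lambda1 : M1 -> R, almost_RB_soliton gL1 Z1 lambda1 rho)
      <-> eq_tensor2 (tracefree g1 B1) (fun _ _ => 0))
  /\
  (forall beta1 : M1 -> R, eq_tensor2 B1 (scale_tensor2 beta1 g1) ->
     let rhs := fun (x : M1) (y : M2) =>
       lambda (x, y) + rho * (RL (x, y) - RL1 x)
       + n2%:R * expR (- 2 * sigma1 x) * (beta1 x + b1 x) in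
     (* the inherited soliton function on the slice over y *)
     (forall (y : M2) (lambda1 : M1 -> R),
        almost_RB_soliton gL1 Z1 lambda1 rho
        <-> (forall x : M1, lambda1 x = rhs x y))
     /\
     (* one soliton structure for all slices iff rhs is independent of y *)
     (forall lambda1 : M2 -> M1 -> R,
        (forall y : M2, almost_RB_soliton gL1 Z1 (lambda1 y) rho) ->
        ((exists lambda0 : M1 -> R, forall y : M2,
            almost_RB_soliton gL1 Z1 lambda0 rho
            /\ (forall x : M1, lambda1 y x = lambda0 x))
         <-> (forall (x : M1) (y y' : M2), rhs x y = rhs x y')))).
Proof.
move=> gL gL1 B1 b1 RL RL1 hsol; split=> [y|beta1 hbeta rhs].
  exact: (inherited_soliton_tracefree hn1 hn2 hM1 hM2 hg1 hg2 hf0 hphi0 hZ1 hZ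
    hsigma1 hk1 hk2 hsigma hk hsol y).
have solP y lambda1 : almost_RB_soliton gL1 Z1 lambda1 rho
    <-> (forall x : M1, lambda1 x = rhs x y).
  exact: (inherited_solitonP hn1 hM1 hM2 hg1 hg2 hf0 hphi0 hZ1 hZ
    hsigma1 hk1 hk2 hsigma hk hsol hbeta y lambda1).
split; first exact: solP.
move=> lambda1 hl; split=> [[lambda0 h0] x y y'|rhs_const].
  have [s _] := h0 y; have [s' _] := h0 y'.
  by rewrite -((solP y lambda0).1 s x) ((solP y' lambda0).1 s' x).
(* The common function is the one attached to a fiber point [y0], with which all others agree once
   [rhs] is constant along fibers. If [M2] is empty the condition is vacuous and any function
   serves. *)
have [y0|noM2] := pselect (inhabited M2); last first.
  by exists (fun=> 0) => y; case: noM2.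
case: y0 => y0; exists (lambda1 y0) => y; split; first exact: hl.
by move=> x; rewrite ((solP y _).1 (hl y) x) ((solP y0 _).1 (hl y0) x).
Qed.
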